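(* Let $E$ be a Banach space and $p\in[1,\infty]$. If $\mathrm{FBL}^{(p)}[E]$ is LWCG, then $E$ is (isomorphic to) a subspace of a WCG Banach space.
   Context: Banach spaces are real. A Banach space is weakly compactly generated (WCG) if it contains a weakly compact set whose linear span is dense. A Banach lattice $X$ is weakly compactly generated as a lattice (LWCG) if there is a weakly compact set $K\subseteq X$ such that the sublattice generated by $K$ is dense in $X$. $H[E]$ is the vector lattice (pointwise operations) of positively homogeneous functions $f:E^*\to\mathbb R$. For $1\le p<\infty$ put $\|f\|_{\mathrm{FBL}^{(p)}[E]}=\sup\{(\sum_{k=1}^n|f(x_k^* )|^p)^{1/p}: n\in\mathbb N,\ x_1^*,\dots,x_n^*\in E^*,\ \sup_{x\in B_E}\sum_{k=1}^n|x_k^*(x)|^p\le 1\}$, and for $p=\infty$ put $\|f\|_{\mathrm{FBL}^{(\infty)}[E]}=\sup_{x^*\in B_{E^*}}|f(x^* )|$. For $x\in E$ let $\delta_x(x^* )=x^*(x)$. $\mathrm{FBL}^{(p)}[E]$ is the closure, in the space of $f\in H[E]$ with finite norm, of the sublattice generated by $\{\delta_x:x\in E\}$. *)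

(* Defs.v *)
From HB Require Import structures.
From mathcomp Require Import all_boot all_order all_algebra.
From mathcomp Require Import all_classical all_reals all_analysis.
From mathcomp Require Import ring.

Set Implicit Arguments.
Unset Strict Implicit.
Unset Printing Implicit Defensive.

Import Order.TTheory GRing.Theory Num.Theory.
Import numFieldNormedType.Exports.

Local Open Scope classical_set_scope.
Local Open Scope ring_scope.

Section Dual.
Variables (R : realType) (V : normedModType R).

Definition functional : {pred V -> R^o} :=
  [pred f | `[< linear f /\ continuous f >]].

Record dual := Dual { dual_fun :> V -> R^o; _ : dual_fun \in functional }.

HB.instance Definition _ := [isSub for dual_fun].
HB.instance Definition _ := [Choice of dual by <:].

Lemma functional_submod_closed : submod_closed functional.
Proof.
split=> [|a f g /asboolP[lf cf] /asboolP[lg cg]]; apply/asboolP.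
  by split=> [a x y|x]; [rewrite /= scaler0 addr0|exact: cst_continuous].
split=> [b x y|x].
  by rewrite !fctE lf lg !scalerDr !scalerA mulrC addrACA.
by apply: cvgD; [apply: cvgZr; exact: cf|exact: cg].
Qed.

HB.instance Definition _ :=
  GRing.isSubmodClosed.Build R (V -> R^o) functional functional_submod_closed.
HB.instance Definition _ := [SubChoice_isSubLmodule of dual by <:].

Lemma dual_linear (phi : dual) : linear phi.
Proof. by have /asboolP[] := valP phi. Qed.

Lemma dual_continuous (phi : dual) : continuous phi.
Proof. by have /asboolP[] := valP phi. Qed.

HB.instance Definition _ (phi : dual) :=
  GRing.isLinear.Build R V R^o *:%R phi (@dual_linear phi).

Lemma dualD (phi psi : dual) x : (phi + psi) x = phi x + psi x.
Proof. by []. Qed.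

Lemma dualZ a (phi : dual) x : (a *: phi) x = a * phi x.
Proof. by []. Qed.

Lemma dualP (phi psi : dual) : (forall x, phi x = psi x) -> phi = psi.
Proof. by move=> h; apply/val_inj/funext. Qed.

Definition dual_norm (phi : dual) : R :=
  sup [set `|phi x| | x in [set x | `|x| <= 1]].

Lemma dual_norm_has_sup (phi : dual) :
  has_sup [set `|phi x| | x in [set x | `|x| <= 1]].
Proof.
split; first by exists `|phi 0|; exists 0 => //=; rewrite normr0.
have /linear_bounded_continuous/linear_boundedP : continuous phi.
  exact: dual_continuous.
move=> /pinfty_ex_gt0[M M0 hM]; exists M => _ [x /= x1 <-].
by rewrite (le_trans (hM x))// ler_piMr// ltW.
Qed.

Implicit Types (phi psi : dual).

Lemma dual_norm_ge0 phi : 0 <= dual_norm phi.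
Proof.
apply: (@le_trans _ _ `|phi 0|) => //.
by apply: sup_upper_bound; [exact: dual_norm_has_sup|exists 0 => //=; rewrite normr0].
Qed.

Lemma le_dual_norm phi x : `|phi x| <= dual_norm phi * `|x|.
Proof.
have [->|x0] := eqVneq x 0; first by rewrite linear0 normr0 mulr_ge0 ?dual_norm_ge0.
rewrite -ler_pdivrMr ?normr_gt0//; apply: sup_upper_bound.
  exact: dual_norm_has_sup.
exists (`|x|^-1 *: x).
  by rewrite /= normrZ normfV normr_id mulVf ?normr_eq0.
by rewrite linearZ/= normrZ normfV normr_id mulrC.
Qed.

Lemma dual_norm_le phi c :
  (forall x, `|x| <= 1 -> `|phi x| <= c) -> dual_norm phi <= c.
Proof.
move=> h; apply: ge_sup; first by have [] := dual_norm_has_sup phi.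
by move=> _ [x /= x1 <-]; exact: h.
Qed.

Let dual_normD phi psi : dual_norm (phi + psi) <= dual_norm phi + dual_norm psi.
Proof.
apply: dual_norm_le => x x1; rewrite dualD (le_trans (ler_normD _ _))// lerD//.
  by rewrite (le_trans (le_dual_norm _ _))// ler_piMr// dual_norm_ge0.
by rewrite (le_trans (le_dual_norm _ _))// ler_piMr// dual_norm_ge0.
Qed.

Let dual_norm_leZ a phi : dual_norm (a *: phi) <= `|a| * dual_norm phi.
Proof.
apply: dual_norm_le => x x1; rewrite dualZ normrM ler_wpM2l//.
by rewrite (le_trans (le_dual_norm _ _))// ler_piMr// dual_norm_ge0.
Qed.

Let dual_normZ a phi : dual_norm (a *: phi) = `|a| * dual_norm phi.
Proof.
apply/eqP; rewrite eq_le dual_norm_leZ/=.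
have [->|a0] := eqVneq a 0; first by rewrite normr0 mul0r dual_norm_ge0.
rewrite -ler_pdivlMl ?normr_gt0// -normfV.
by rewrite (le_trans _ (dual_norm_leZ _ _))// scalerK.
Qed.

Let dual_norm0_eq0 phi : dual_norm phi = 0 -> phi = 0.
Proof.
move=> h; apply: dualP => x; apply/eqP; rewrite -normr_le0.
by rewrite (le_trans (le_dual_norm _ _))// h mul0r.
Qed.

HB.instance Definition _ :=
  Lmodule_isNormed.Build R dual dual_normD dual_normZ dual_norm0_eq0.

End Dual.

(* The weak topology is the initial topology of V -> R^(dual V). *)
Section WeakTopology.
Variables (R : realType) (V : normedModType R).

Definition weak_eval (x : V) : prod_topology (fun _ : dual V => R : topologicalType) :=
  fun phi => phi x.

Definition weakly_compact (K : set V) := compact (K : set (initial_topology weak_eval)).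

End WeakTopology.

Section WCG.
Variables (R : realType) (V : normedModType R).

Definition linear_subspace (S : set V) :=
  S 0 /\ forall (a : R) x y, S x -> S y -> S (a *: x + y).

Definition linear_span (A : set V) := smallest linear_subspace A.

Definition WCG := exists2 K : set V, weakly_compact K & dense (linear_span K).

End WCG.

(* The order lives in the mixin because Order.Lattice cannot be joined with
   the normed-module hierarchy (HB reports missing joins below numDomainType). *)
HB.mixin Record Lmodule_isVectorLattice (R : numDomainType) V
    & GRing.Lmodule R V := {
  vle : V -> V -> Prop;
  vsup : V -> V -> V;
  vinf : V -> V -> V;
  vle_refl : forall x, vle x x;
  vle_anti : forall x y, vle x y -> vle y x -> x = y;
  vle_trans : forall y x z, vle x y -> vle y z -> vle x z;
  vsupP : forall x y z, vle (vsup x y) z <-> vle x z /\ vle y z;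
  vinfP : forall x y z, vle z (vinf x y) <-> vle z x /\ vle z y;
  vleD2r : forall z x y, vle x y -> vle (x + z) (y + z);
  vle_scale : forall a x, 0 <= a -> vle 0 x -> vle 0 (a *: x)
}.

#[short(type="vectorLatticeType")]
HB.structure Definition VectorLattice (R : numDomainType) :=
  {V of GRing.Lmodule R V & Lmodule_isVectorLattice R V}.

Arguments vle_trans {R s} [y x z].
Arguments vle_anti {R s} [x y].
Arguments vleD2r {R s} z [x y].

Section VectorLatticeTheory.
Variables (R : numFieldType) (V : vectorLatticeType R).
Implicit Types (x y z : V) (A S : set V).

Definition vabs x := vsup x (- x).

Definition vector_sublattice S :=
  [/\ S 0,
      (forall (a : R) x y, S x -> S y -> S (a *: x + y)),
      (forall x y, S x -> S y -> S (vsup x y)) &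
      (forall x y, S x -> S y -> S (vinf x y))].

Definition sublattice_gen A := smallest vector_sublattice A.

Lemma sublattice_gen_sub A : A `<=` sublattice_gen A.
Proof. exact: sub_gen_smallest. Qed.

Lemma sublattice_gen_sublattice A : vector_sublattice (sublattice_gen A).
Proof.
split=> [S [[]]//|a x y Sx Sy S SA|x y Sx Sy S SA|x y Sx Sy S SA].
- by have [[_ h _ _] _] := SA; apply: h; [exact: Sx|exact: Sy].
- by have [[_ _ h _] _] := SA; apply: h; [exact: Sx|exact: Sy].
- by have [[_ _ _ h] _] := SA; apply: h; [exact: Sx|exact: Sy].
Qed.

Lemma vsup_ubl x y : vle x (vsup x y).
Proof. by have /vsupP[] := vle_refl (vsup x y). Qed.

Lemma vsup_ubr x y : vle y (vsup x y).
Proof. by have /vsupP[] := vle_refl (vsup x y). Qed.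

Lemma vinf_lbl x y : vle (vinf x y) x.
Proof. by have /vinfP[] := vle_refl (vinf x y). Qed.

Lemma vinf_lbr x y : vle (vinf x y) y.
Proof. by have /vinfP[] := vle_refl (vinf x y). Qed.

Lemma vleD x y z t : vle x y -> vle z t -> vle (x + z) (y + t).
Proof.
move=> xy zt; apply: (vle_trans (vleD2r z xy)).
by rewrite ![y + _]addrC; exact: vleD2r.
Qed.

Lemma vleN x y : vle x y -> vle (- y) (- x).
Proof.
by move=> /(vleD2r (- x - y)); rewrite addrA subrr sub0r addrCA subrr addr0.
Qed.

Lemma vleBl x y z : vle (x - y) z -> vle x (z + y).
Proof. by move=> /(vleD2r y); rewrite subrK. Qed.

Lemma vleBr x y z : vle x (z + y) -> vle (x - y) z.
Proof. by move=> /(vleD2r (- y)); rewrite addrK. Qed.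

Lemma vabs_ge0 x : vle 0 (vabs x).
Proof.
have := vleD (vsup_ubl x (- x)) (vsup_ubr x (- x)); rewrite subrr => h.
have -> : vabs x = 2^-1 *: (vabs x + vabs x).
  by rewrite -mulr2n -(scaler_nat 2 (vabs x)) scalerA mulVf ?scale1r.
by apply: vle_scale => //; rewrite invr_ge0.
Qed.

Lemma vabs_ge0_id x : vle 0 x -> vabs x = x.
Proof.
move=> x0; apply: vle_anti; last exact: vsup_ubl.
apply/vsupP; split; first exact: vle_refl.
by apply: (vle_trans _ x0); move/vleN : x0; rewrite oppr0.
Qed.

Lemma vabsN x : vabs (- x) = vabs x.
Proof.
by apply: vle_anti; apply/vsupP; split;
  rewrite ?opprK; (exact: vsup_ubl) || (exact: vsup_ubr) ||
  (rewrite -{1}[x]opprK; exact: vsup_ubr).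
Qed.

Lemma vsup_dist x y x' y' :
  vle (vabs (vsup x y - vsup x' y')) (vabs (x - x') + vabs (y - y')).
Proof.
have H u v u' v' : vle (vsup u v - vsup u' v') (vabs (u - u') + vabs (v - v')).
  apply/vleBr/vsupP; split.
    rewrite -[X in vle X _](subrK u') -[X in vle (X + _) _]addr0.
    by apply: vleD; [apply: vleD; [exact: vsup_ubl|exact: vabs_ge0]|exact: vsup_ubl].
  rewrite -[X in vle X _](subrK v') -[X in vle (X + _) _]add0r.
  by apply: vleD; [apply: vleD; [exact: vabs_ge0|exact: vsup_ubl]|exact: vsup_ubr].
apply/vsupP; split; first exact: H.
by rewrite opprB -(vabsN (x - _)) -(vabsN (y - _)) !opprB; exact: H.
Qed.

Lemma vinfE x y : vinf x y = - vsup (- x) (- y).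
Proof.
apply: vle_anti.
  rewrite -[vinf x y]opprK; apply: vleN; apply/vsupP.
  by split; apply: vleN; [exact: vinf_lbl|exact: vinf_lbr].
apply/vinfP; split.
  by rewrite -[X in vle _ X]opprK; apply/vleN/vsup_ubl.
by rewrite -[X in vle _ X]opprK; apply/vleN/vsup_ubr.
Qed.

End VectorLatticeTheory.

HB.mixin Record NormedVectorLattice_isBanachLattice (R : realType) V
    & CompleteNormedModule R V & VectorLattice R V := {
  norm_vabs_le : forall x y : V, vle (vabs x) (vabs y) -> `|x| <= `|y|
}.

#[short(type="banachLatticeType")]
HB.structure Definition BanachLattice (R : realType) :=
  {V of CompleteNormedModule R V & VectorLattice R V
   & NormedVectorLattice_isBanachLattice R V}.

Definition LWCG (R : realType) (V : banachLatticeType R) :=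
  exists2 K : set V, weakly_compact K & dense (sublattice_gen K).

Lemma closure_normP (R : realType) (V : normedModType R) (S : set V) (x : V) :
  closure S x <-> forall e : R, 0 < e -> exists2 y, S y & `|x - y| < e.
Proof.
split=> [Sx e e0|h B /nbhs_normP[e /= e0 eB]].
  have [y [Sy]] := Sx _ (nbhsx_ballx x e e0).
  by rewrite -ball_normE; exists y.
by have [y Sy xye] := h e e0; exists y; split=> //; exact: eB.
Qed.

Lemma vsup_norm_dist (R : realType) (V : banachLatticeType R) (x y x' y' : V) :
  `|vsup x y - vsup x' y'| <= `|x - x'| + `|y - y'|.
Proof.
have nE (z : V) : `|vabs z| = `|z|.
  by apply/eqP; rewrite eq_le; apply/andP; split; apply: norm_vabs_le;
    rewrite (vabs_ge0_id (vabs_ge0 z)); exact: vle_refl.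
rewrite -(nE (x - x')) -(nE (y - y')) (le_trans _ (ler_normD _ _))//.
apply: norm_vabs_le; rewrite [vabs (vabs _ + _)]vabs_ge0_id; first exact: vsup_dist.
by rewrite -[0]addr0; apply: vleD; exact: vabs_ge0.
Qed.

Section ClosedSublattice.
Variables (R : realType) (V : banachLatticeType R) (A : set V).

Definition closed_sublattice_pred : {pred V} :=
  [pred x | `[< closure (sublattice_gen A) x >]].

Record closed_sublattice := ClosedSublattice {
  closed_sublattice_val :> V;
  _ : closed_sublattice_val \in closed_sublattice_pred }.

HB.instance Definition _ := [isSub for closed_sublattice_val].
HB.instance Definition _ := [Choice of closed_sublattice by <:].

Let clP x : reflect (forall e : R, 0 < e -> exists2 y, sublattice_gen A y & `|x - y| < e)
  (x \in closed_sublattice_pred).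
Proof.
by apply: (iffP idP) => [/asboolP/closure_normP//|h]; apply/asboolP/closure_normP.
Qed.

Lemma closed_sublattice_submod_closed : submod_closed closed_sublattice_pred.
Proof.
have [S0 SD _ _] := sublattice_gen_sublattice A.
split=> [|a x y /clP cx /clP cy]; apply/clP => e e0.
  by exists 0 => //; rewrite subrr normr0.
have d0 : 0 < e / 2 / (`|a| + 1) by rewrite !divr_gt0// ltr_wpDl.
have [x' Sx' xx'] := cx _ d0; have [y' Sy' yy'] := cy _ (divr_gt0 e0 (ltr0n _ 2)).
exists (a *: x' + y'); first exact: SD.
rewrite opprD addrACA -scalerBr (le_lt_trans (ler_normD _ _))// (splitr e).
rewrite ler_ltD// normrZ.
rewrite (@le_trans _ _ (`|a| * (e / 2 / (`|a| + 1))))//.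
  by rewrite ler_wpM2l// ltW.
rewrite mulrCA ler_piMr//; first by rewrite divr_ge0// ltW.
by rewrite ler_pdivrMr ?mul1r ?lerDl// ltr_wpDl.
Qed.

HB.instance Definition _ := GRing.isSubmodClosed.Build R V
  closed_sublattice_pred closed_sublattice_submod_closed.
HB.instance Definition _ := [SubChoice_isSubLmodule of closed_sublattice by <:].

Lemma closed_sublattice_sup x y : x \in closed_sublattice_pred ->
  y \in closed_sublattice_pred -> vsup x y \in closed_sublattice_pred.
Proof.
have [_ _ Ssup _] := sublattice_gen_sublattice A.
move=> /clP cx /clP cy; apply/clP => e e0.
have [x' Sx' xx'] := cx _ (divr_gt0 e0 (ltr0n _ 2)).
have [y' Sy' yy'] := cy _ (divr_gt0 e0 (ltr0n _ 2)).
exists (vsup x' y'); first exact: Ssup.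
by rewrite (le_lt_trans (vsup_norm_dist _ _ _ _))// (splitr e) ltrD.
Qed.

Lemma closed_sublattice_inf x y : x \in closed_sublattice_pred ->
  y \in closed_sublattice_pred -> vinf x y \in closed_sublattice_pred.
Proof. by move=> cx cy; rewrite vinfE rpredN closed_sublattice_sup ?rpredN. Qed.

Implicit Types x y z : closed_sublattice.

Definition cs_le x y := vle (x : V) (y : V).
Definition cs_sup x y : closed_sublattice :=
  ClosedSublattice (closed_sublattice_sup (valP x) (valP y)).
Definition cs_inf x y : closed_sublattice :=
  ClosedSublattice (closed_sublattice_inf (valP x) (valP y)).

Let cs_le_refl x : cs_le x x. Proof. exact: vle_refl. Qed.
Let cs_le_anti x y : cs_le x y -> cs_le y x -> x = y.
Proof. by move=> xy yx; apply/val_inj/vle_anti. Qed.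
Let cs_le_trans y x z : cs_le x y -> cs_le y z -> cs_le x z.
Proof. exact: vle_trans. Qed.
Let cs_supP x y z : cs_le (cs_sup x y) z <-> cs_le x z /\ cs_le y z.
Proof. exact: vsupP. Qed.
Let cs_infP x y z : cs_le z (cs_inf x y) <-> cs_le z x /\ cs_le z y.
Proof. exact: vinfP. Qed.
Let cs_leD2r z x y : cs_le x y -> cs_le (x + z) (y + z).
Proof. exact: vleD2r. Qed.
Let cs_le_scale (a : R) x : 0 <= a -> cs_le 0 x -> cs_le 0 (a *: x).
Proof. exact: vle_scale. Qed.

HB.instance Definition _ := Lmodule_isVectorLattice.Build R closed_sublattice
  cs_le_refl cs_le_anti cs_le_trans cs_supP cs_infP cs_leD2r cs_le_scale.

Definition cs_norm x : R := `|x : V|.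

Let cs_normD x y : cs_norm (x + y) <= cs_norm x + cs_norm y.
Proof. exact: ler_normD. Qed.
Let cs_normZ (a : R) x : cs_norm (a *: x) = `|a| * cs_norm x.
Proof. exact: normrZ. Qed.
Let cs_norm0_eq0 x : cs_norm x = 0 -> x = 0.
Proof. by move=> x0; apply/val_inj/normr0_eq0. Qed.

HB.instance Definition _ := Lmodule_isNormed.Build R closed_sublattice
  cs_normD cs_normZ cs_norm0_eq0.

Let cs_complete (F : set_system closed_sublattice) :
  ProperFilter F -> cauchy F -> cvg F.
Proof.
move=> FF /cauchyP Fc.
pose G : set_system V := closed_sublattice_val @ F.
have GF : ProperFilter G by exact: fmap_proper_filter.
have Gc : cauchy G.
  apply/cauchyP => e e0; have [x Fx] := Fc e e0; exists (x : V).
  by rewrite /G/=; apply: filterS Fx => y; rewrite -!ball_normE.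
pose l := lim G; have Gl : G --> l by exact: (@cauchy_cvg V G GF Gc).
have cl : l \in closed_sublattice_pred.
  apply/clP => e e0.
  have : F (closed_sublattice_val @^-1` ball l (e / 2)).
    by apply: (Gl (ball l (e / 2))); apply: nbhsx_ballx; rewrite divr_gt0.
  move=> /filter_ex[y]; rewrite -ball_normE/= => lye.
  have /clP/(_ _ (divr_gt0 e0 (ltr0n R 2)))[z Sz yze] := valP y.
  exists z => //; rewrite -(subrK (y : V) l) -addrA (le_lt_trans (ler_normD _ _))//.
  by rewrite (splitr e) ltrD.
apply/cvg_ex; exists (ClosedSublattice cl).
move=> B /nbhs_normP[e /= e0 eB].
have : F (closed_sublattice_val @^-1` ball l e).
  by apply: (Gl (ball l e)); exact: nbhsx_ballx.
by apply: filterS => y; rewrite /preimage/= -ball_normE => lye; exact: eB.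
Qed.

HB.instance Definition _ := Uniform_isComplete.Build closed_sublattice cs_complete.

Let cs_norm_vabs_le x y : vle (vabs x) (vabs y) -> `|x| <= `|y|.
Proof. exact: (@norm_vabs_le R V). Qed.

HB.instance Definition _ :=
  NormedVectorLattice_isBanachLattice.Build R closed_sublattice cs_norm_vabs_le.

End ClosedSublattice.

Section FiniteLp.
Variables (R : realType) (r : R).
Hypothesis r1 : 1 <= r.

Let r0 : 0 < r. Proof. exact: lt_le_trans r1. Qed.

Let powR_mono (s a b : R) : 0 <= s -> 0 <= a -> a <= b -> a `^ s <= b `^ s.
Proof.
by move=> s0 a0 ab; apply: ge0_ler_powR; rewrite ?nnegrE// (le_trans a0).
Qed.

Let powRK (a : R) : 0 <= a -> (a `^ r) `^ r^-1 = a.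
Proof. by move=> a0; rewrite -powRrM mulfV ?gt_eqF// powRr1. Qed.

Definition lp_norm n (v : 'I_n -> R) : R := (\sum_(k < n) `|v k| `^ r) `^ r^-1.

Lemma lp_norm_ge0 n (v : 'I_n -> R) : 0 <= lp_norm v.
Proof. exact: powR_ge0. Qed.

Let sum_ge0 n (v : 'I_n -> R) : 0 <= \sum_(k < n) `|v k| `^ r.
Proof. by apply: sumr_ge0 => k _; exact: powR_ge0. Qed.

Lemma lp_norm_powR n (v : 'I_n -> R) : lp_norm v `^ r = \sum_(k < n) `|v k| `^ r.
Proof. by rewrite -powRrM mulVf ?gt_eqF// powRr1. Qed.

Lemma lp_norm_leP n (v : 'I_n -> R) c : 0 <= c ->
  (lp_norm v <= c) = (\sum_(k < n) `|v k| `^ r <= c `^ r).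
Proof.
move=> c0; rewrite -lp_norm_powR; apply/idP/idP => h.
  by apply: ge0_ler_powR; rewrite ?nnegrE ?lp_norm_ge0 // ltW.
have ir0 : 0 <= r^-1 by rewrite invr_ge0 ltW.
by have := powR_mono ir0 (powR_ge0 _ _) h; rewrite !powRK ?lp_norm_ge0.
Qed.

Lemma le_lp_norm n (u v : 'I_n -> R) :
  (forall k, `|u k| <= `|v k|) -> lp_norm u <= lp_norm v.
Proof.
move=> uv; rewrite lp_norm_leP ?lp_norm_ge0// lp_norm_powR ler_sum// => k _.
by apply: ge0_ler_powR; rewrite ?nnegrE// ltW.
Qed.

Lemma lp_normZ n a (v : 'I_n -> R) : lp_norm (fun k => a * v k) = `|a| * lp_norm v.
Proof.
rewrite /lp_norm; under eq_bigr do rewrite normrM powRM//.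
rewrite -mulr_sumr powRM ?powR_ge0// -powRrM mulfV ?gt_eqF// powRr1//.
Qed.

Lemma lp_norm_coord n (v : 'I_n -> R) k : `|v k| <= lp_norm v.
Proof.
have ir0 : 0 <= r^-1 by rewrite invr_ge0 ltW.
rewrite -(powRK (normr_ge0 (v k))); apply: powR_mono; rewrite ?powR_ge0//.
by rewrite (bigD1 k)//= lerDl sumr_ge0// => i _; exact: powR_ge0.
Qed.

Lemma lp_normD n (u v : 'I_n -> R) :
  lp_norm (fun k => u k + v k) <= lp_norm u + lp_norm v.
Proof.
have [u0|u0] := eqVneq (lp_norm u) 0.
  rewrite u0 add0r; apply: le_lp_norm => k.
  suff -> : u k = 0 by rewrite add0r.
  by apply/eqP; rewrite -normr_le0 -u0 lp_norm_coord.
have [v0|v0] := eqVneq (lp_norm v) 0.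
  rewrite v0 addr0; apply: le_lp_norm => k.
  suff -> : v k = 0 by rewrite addr0.
  by apply/eqP; rewrite -normr_le0 -v0 lp_norm_coord.
have {u0} a0 : 0 < lp_norm u by rewrite lt_neqAle eq_sym u0 lp_norm_ge0.
have {v0} b0 : 0 < lp_norm v by rewrite lt_neqAle eq_sym v0 lp_norm_ge0.
rewrite lp_norm_leP; last by apply: addr_ge0; exact: lp_norm_ge0.
have Su := lp_norm_powR u; have Sv := lp_norm_powR v.
move: (lp_norm u) (lp_norm v) a0 b0 Su Sv => a b a0 b0 Su Sv.
have ab0 : 0 < a + b by exact: addr_gt0.
pose t := a / (a + b); pose t' := b / (a + b).
have tt' : t + t' = 1 by rewrite /t /t' -mulrDl mulfV ?gt_eqF.
have t0 : 0 <= t by apply: divr_ge0; exact: ltW.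
have t'0 : 0 <= t' by apply: divr_ge0; exact: ltW.
have t1 : t <= 1 by rewrite -tt' lerDl.
have h k : `|u k + v k| `^ r <=
    (a + b) `^ r * (t * (`|u k| / a) `^ r + t' * (`|v k| / b) `^ r).
  have ua : 0 <= `|u k| / a by apply: divr_ge0; [exact: normr_ge0|exact: ltW].
  have vb : 0 <= `|v k| / b by apply: divr_ge0; [exact: normr_ge0|exact: ltW].
  have s0 : 0 <= t * (`|u k| / a) + t' * (`|v k| / b).
    by apply: addr_ge0; apply: mulr_ge0.
  apply: (@le_trans _ _ (((a + b) * (t * (`|u k| / a) + t' * (`|v k| / b))) `^ r)).
    apply: powR_mono => //; first exact: ltW.
    rewrite [leRHS](_ : _ = `|u k| + `|v k|) ?ler_normD//.
    by rewrite /t /t'; field; rewrite (gt_eqF ab0) (gt_eqF a0) (gt_eqF b0).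
  rewrite powRM//; last exact: ltW.
  apply: ler_wpM2l; first exact: powR_ge0.
  have := @convex_powR R r r1 (Itv01 t0 t1) (`|u k| / a) (`|v k| / b).
  rewrite convRE [X in X `^ _ <= _]convRE/= /unstable.onem -tt' addrAC subrr add0r.
  by apply; rewrite inE/= in_itv/= andbT.
apply: le_trans (ler_sum _ (fun k _ => h k)) _.
rewrite -mulr_sumr; apply: ler_piMr; first exact: powR_ge0.
rewrite big_split/= -!mulr_sumr.
have H (w : 'I_n -> R) c : 0 < c -> c `^ r = \sum_(k < n) `|w k| `^ r ->
    \sum_(k < n) (`|w k| / c) `^ r = 1.
  move=> c0 cE; have ic0 : 0 <= c^-1 by rewrite invr_ge0 ltW.
  under eq_bigr do rewrite powRM//.
  rewrite -mulr_suml -cE -powRM//; last exact: ltW.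
  by rewrite mulfV ?gt_eqF// powR1.
by rewrite (H u a)// (H v b)// !mulr1 tt'.
Qed.

End FiniteLp.

Section PosHom.
Variables (R : realType) (E : normedModType R).

Definition positively_homogeneous : {pred dual E -> R^o} :=
  [pred f | `[< forall (a : R) (phi : dual E), 0 <= a -> f (a *: phi) = a * f phi >]].

Record posHom := PosHom {
  posHom_fun :> dual E -> R^o;
  _ : posHom_fun \in positively_homogeneous }.

HB.instance Definition _ := [isSub for posHom_fun].
HB.instance Definition _ := [Choice of posHom by <:].

Lemma positively_homogeneous_submod_closed : submod_closed positively_homogeneous.
Proof.
split=> [|a f g /asboolP hf /asboolP hg]; apply/asboolP=> b phi b0.
  by rewrite mulr0.
by rewrite !fctE hf// hg// scalerAr -mulrDr.
Qed.

HB.instance Definition _ := GRing.isSubmodClosed.Build R (dual E -> R^o)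
  positively_homogeneous positively_homogeneous_submod_closed.
HB.instance Definition _ := [SubChoice_isSubLmodule of posHom by <:].

Implicit Types f g h : posHom.

Lemma posHomP f a (phi : dual E) : 0 <= a -> f (a *: phi) = a * f phi.
Proof. by have /asboolP := valP f; apply. Qed.

Let max_subproof f g :
  (fun phi => Num.max (f phi) (g phi) : R^o) \in positively_homogeneous.
Proof. by apply/asboolP => a phi a0; rewrite !posHomP// maxr_pMr. Qed.

Let min_subproof f g :
  (fun phi => Num.min (f phi) (g phi) : R^o) \in positively_homogeneous.
Proof. by apply/asboolP => a phi a0; rewrite !posHomP// minr_pMr. Qed.

Definition posHom_le f g := forall phi, f phi <= g phi :> R.
Definition posHom_sup f g : posHom := PosHom (max_subproof f g).
Definition posHom_inf f g : posHom := PosHom (min_subproof f g).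

Let ph_le_refl f : posHom_le f f. Proof. by move=> phi. Qed.
Let ph_le_anti f g : posHom_le f g -> posHom_le g f -> f = g.
Proof.
by move=> fg gf; apply/val_inj/funext => phi; apply/le_anti; rewrite fg gf.
Qed.
Let ph_le_trans g f h : posHom_le f g -> posHom_le g h -> posHom_le f h.
Proof. by move=> fg gh phi; exact: le_trans (fg phi) (gh phi). Qed.
Let supP f g h : posHom_le (posHom_sup f g) h <-> posHom_le f h /\ posHom_le g h.
Proof.
split=> [H|[fh gh] phi]; last by rewrite /= ge_max fh gh.
by split=> phi; have := H phi; rewrite /= ge_max => /andP[].
Qed.
Let infP f g h : posHom_le h (posHom_inf f g) <-> posHom_le h f /\ posHom_le h g.
Proof.
split=> [H|[fh gh] phi]; last by rewrite /= le_min fh gh.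
by split=> phi; have := H phi; rewrite /= le_min => /andP[].
Qed.
Let leD2r h f g : posHom_le f g -> posHom_le (f + h) (g + h).
Proof. by move=> fg phi; apply: lerD. Qed.
Let le_scale (a : R) f : 0 <= a -> posHom_le 0 f -> posHom_le 0 (a *: f).
Proof. by move=> a0 f0 phi; apply: mulr_ge0 => //; exact: f0. Qed.

HB.instance Definition _ := Lmodule_isVectorLattice.Build R posHom
  ph_le_refl ph_le_anti ph_le_trans supP infP leD2r le_scale.

Lemma posHom_absE f phi : vabs f phi = `|f phi|.
Proof. by rewrite -maxrN. Qed.

Let eval_subproof (x : E) : (fun phi : dual E => phi x) \in positively_homogeneous.
Proof. by apply/asboolP. Qed.

Definition posHom_eval (x : E) : posHom := PosHom (eval_subproof x).

End PosHom.

Section FBLNorm.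
Variables (R : realType) (E : normedModType R).
Implicit Types (p : \bar R) (f g : dual E -> R).

(* Meaningful for 1 <= p only; the case -oo is a dummy value. *)
Definition fbl_norm p f : \bar R :=
  match p with
  | r%:E => ereal_sup [set y | exists n (xs : 'I_n -> dual E),
      (ereal_sup [set (\sum_(k < n) `|xs k x| `^ r)%:E
                    | x in [set x : E | (`|x| <= 1)%R]] <= 1)%E
      /\ y = (lp_norm r (fun k => f (xs k)))%:E]
  | +oo => ereal_sup [set `|f phi|%:E | phi in [set phi : dual E | (`|phi| <= 1)%R]]
  | -oo => 0
  end%E.

Let dom p n (xs : 'I_n -> dual E) : Prop :=
  match p with
  | r%:E => forall x : E, `|x| <= 1 -> \sum_(k < n) `|xs k x| `^ r <= 1
  | +oo%E => n = 1%N /\ forall k, `|xs k| <= 1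
  | -oo%E => False
  end.

Let ex p : R := if p is r%:E then r else 1.

Variables (p : \bar R) (p1 : (1 <= p)%E).

Let ex1 : 1 <= ex p.
Proof. by move: p p1 => [r||]//=. Qed.

Let lp1 f (phi : dual E) : lp_norm (ex p) (fun k : 'I_1 => f phi) = `|f phi|.
Proof.
rewrite /lp_norm big_ord1 -powRrM mulfV ?powRr1//.
by rewrite gt_eqF// (lt_le_trans ltr01 ex1).
Qed.

Let ub f n (xs : 'I_n -> dual E) : dom p xs ->
  ((lp_norm (ex p) (fun k => f (xs k)))%:E <= fbl_norm p f)%E.
Proof.
move: p p1 ex1 lp1 => [r||]//= r1 ex1' lp1' h; apply: ereal_sup_ubound.
  exists n, xs; split=> //; apply: ge_ereal_sup => _ [x /= x1 <-].
  by rewrite lee_fin; exact: h.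
case: h => n1 h; subst n; exists (xs ord0); first exact: h.
have -> : (fun k => f (xs k)) = (fun _ : 'I_1 => f (xs ord0)).
  by apply/funext => k; rewrite (ord1 k).
by rewrite -[in LHS](lp1' f).
Qed.

Let le_bound f (c : \bar R) :
  (forall n (xs : 'I_n -> dual E), dom p xs ->
     ((lp_norm (ex p) (fun k => f (xs k)))%:E <= c)%E) ->
  (fbl_norm p f <= c)%E.
Proof.
move: p p1 lp1 => [r||]//= r1 lp1' h; apply: ge_ereal_sup.
  move=> _ [n [xs [xs1 ->]]]; apply: h => x x1; rewrite -lee_fin.
  by apply: le_trans xs1; apply: ereal_sup_ubound; exists x.
move=> _ [phi /= phi1 <-]; rewrite -lp1'; apply: h; split=> //.
Qed.

Let dom1 (phi : dual E) : `|phi| <= 1 -> dom p (fun _ : 'I_1 => phi).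
Proof.
move: p p1 => [r||]//= r1 phi1.
move=> x x1; rewrite big_ord1 -[leRHS](congr1 (fun h => h r) (powR1 R)); apply: ge0_ler_powR.
- by rewrite (le_trans ler01).
- by rewrite nnegrE.
- by rewrite nnegrE.
- by rewrite (le_trans (le_dual_norm _ _))// mulr_ile1// dual_norm_ge0.
Qed.

Lemma fbl_norm_ubound f phi : `|phi| <= 1 -> (`|f phi|%:E <= fbl_norm p f)%E.
Proof. by move=> /dom1 /ub - /(_ f); rewrite lp1. Qed.

Lemma fbl_norm_ge0 f : (0 <= fbl_norm p f)%E.
Proof.
apply: le_trans (fbl_norm_ubound f (_ : `|0| <= 1)); rewrite ?lee_fin//.
by rewrite normr0.
Qed.

Lemma le_fbl_norm f g :
  (forall phi, `|f phi| <= `|g phi|) -> (fbl_norm p f <= fbl_norm p g)%E.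
Proof.
move=> fg; apply: le_bound => n xs Dxs; apply: le_trans (ub g Dxs).
by rewrite lee_fin le_lp_norm.
Qed.

Lemma fbl_normD f g :
  (fbl_norm p (fun phi => f phi + g phi)%R <= fbl_norm p f + fbl_norm p g)%E.
Proof.
apply: le_bound => n xs Dxs; apply: le_trans (leeD (ub f Dxs) (ub g Dxs)).
by rewrite -EFinD lee_fin lp_normD.
Qed.

Lemma fbl_norm_leZ a f : (fbl_norm p (fun phi => a * f phi)%R <= `|a|%:E * fbl_norm p f)%E.
Proof.
apply: le_bound => n xs Dxs; rewrite lp_normZ// EFinM.
by apply: lee_wpmul2l; [rewrite lee_fin|exact: ub].
Qed.

Lemma fbl_norm_eval (x : E) : (fbl_norm p (fun phi => phi x) <= `|x|%:E)%E.
Proof.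
apply: le_bound => n xs Dxs; rewrite lee_fin.
have [x0|x0] := eqVneq x 0.
  have -> : (fun k => xs k x : R) = (fun=> 0 * 1).
    by apply/funext => k; rewrite x0 linear0 mul0r.
  by rewrite lp_normZ// normr0 mul0r.
have -> : (fun k => xs k x : R) = (fun k => `|x| * xs k (`|x|^-1 *: x)).
  by apply/funext => k; rewrite linearZ/= mulrA mulfV ?mul1r ?normr_eq0.
rewrite lp_normZ// normr_id ler_piMr//.
set y := _ *: x; have y1 : `|y| <= 1.
  by rewrite normrZ normfV normr_id mulVf// normr_eq0.
rewrite lp_norm_leP// powR1.
move: p p1 Dxs => [r||]//= r1; first exact.
case=> n1; subst n => xs1; rewrite big_ord1 powRr1//.
by rewrite (le_trans (le_dual_norm _ _))// mulr_ile1// ?dual_norm_ge0//; exact: xs1.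
Qed.

Lemma fbl_norm_lim (T : Type) (F : set_system T) (u : T -> dual E -> R) f g c :
  ProperFilter F -> (forall phi, u ^~ phi @ F --> f phi) ->
  (\forall t \near F, (fbl_norm p (fun phi => u t phi - g phi)%R <= c%:E)%E) ->
  (fbl_norm p (fun phi => f phi - g phi)%R <= c%:E)%E.
Proof.
move=> FF uf uc; apply: le_bound => n xs Dxs; rewrite lee_fin.
apply/ler_addgt0Pr => e e0.
pose M := lp_norm (ex p) (fun _ : 'I_n => 1) + 1.
have M0 : 0 < M by rewrite ltr_wpDl// lp_norm_ge0.
have H : \forall t \near F, forall k, `|f (xs k) - u t (xs k)| <= e / M.
  apply: filter_forall => k.
  have /cvgrPdist_le/(_ (e / M)) := uf (xs k); apply.
  by rewrite divr_gt0.
have [t [Ht ct]] := filter_ex (filterI H uc).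
have -> : (fun k => f (xs k) - g (xs k)) =
    (fun k => (f (xs k) - u t (xs k)) + (u t (xs k) - g (xs k))).
  by apply/funext => k; rewrite addrA subrK.
rewrite (le_trans (lp_normD ex1 _ _))// addrC lerD//.
  by rewrite -lee_fin (le_trans _ ct)//; exact: (ub (fun phi => u t phi - g phi) Dxs).
apply: (@le_trans _ _ (lp_norm (ex p) (fun _ : 'I_n => e / M * 1))).
  by apply: le_lp_norm => // k; rewrite mulr1 [leRHS]ger0_norm// divr_ge0// ltW.
rewrite lp_normZ// ger0_norm ?divr_ge0 ?(ltW e0) ?(ltW M0)//.
by rewrite mulrAC ler_pdivrMr// ler_pM2l// /M lerDl.
Qed.

End FBLNorm.

Section FiniteFBLNorm.
Variables (R : realType) (E : normedModType R) (p : \bar R).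

Definition fbl_finite : {pred posHom E} := [pred f : posHom E | (fbl_norm p f < +oo)%E].

(* The proof of 1 <= p indexes the type because the triangle inequality,
   hence the Banach lattice structure, depends on it. *)
Record fbl_fin (p1 : (1 <= p)%E) :=
  FBLFin { fblFin_val :> posHom E; _ : fblFin_val \in fbl_finite }.

Variable p1 : (1 <= p)%E.
Local Notation fblFin := (fbl_fin p1).

HB.instance Definition _ := [isSub for @fblFin_val p1].
HB.instance Definition _ := [Choice of fblFin by <:].

Let fin_le (f g : posHom E) :
  (forall phi, `|f phi| <= `|g phi|) -> g \in fbl_finite -> f \in fbl_finite.
Proof. by move=> fg; rewrite !inE; apply: le_lt_trans; exact: le_fbl_norm. Qed.

Let eval_fin (x : E) : posHom_eval x \in fbl_finite.
Proof. by rewrite inE; apply: le_lt_trans (fbl_norm_eval p1 x) (ltry _). Qed.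

Lemma fbl_finite_submod_closed : submod_closed fbl_finite.
Proof.
split=> [|a f g].
  by apply: fin_le (eval_fin 0) => phi; rewrite normr0.
rewrite !inE => fp gp.
apply: le_lt_trans (fbl_normD p1 (fun phi => a * f phi) g) _.
apply: lte_add_pinfty => //; apply: le_lt_trans (fbl_norm_leZ p1 a f) _.
by apply: lte_mul_pinfty => //; rewrite lee_fin.
Qed.

HB.instance Definition _ := GRing.isSubmodClosed.Build R (posHom E)
  fbl_finite fbl_finite_submod_closed.
HB.instance Definition _ := [SubChoice_isSubLmodule of fblFin by <:].

Let fin_abs (f : posHom E) : f \in fbl_finite -> vabs f \in fbl_finite.
Proof. by apply: fin_le => phi; rewrite posHom_absE normr_id. Qed.

Let fin_sup (f g : posHom E) :
  f \in fbl_finite -> g \in fbl_finite -> vsup f g \in fbl_finite.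
Proof.
move=> fp gp; apply: (@fin_le _ (vabs f + vabs g)).
  move=> phi; have -> : (vabs f + vabs g : posHom E) phi = `|f phi| + `|g phi|.
    by rewrite -!posHom_absE.
  rewrite [leRHS]ger0_norm ?addr_ge0//.
  by rewrite /vsup/= maxEle; case: ifPn => _; rewrite ?lerDl ?lerDr.
by apply: rpredD; exact: fin_abs.
Qed.

Let fin_inf (f g : posHom E) :
  f \in fbl_finite -> g \in fbl_finite -> vinf f g \in fbl_finite.
Proof. by move=> fp gp; rewrite vinfE rpredN fin_sup ?rpredN. Qed.

Implicit Types f g h : fblFin.

Definition fblFin_le f g := vle (f : posHom E) (g : posHom E).
Definition fblFin_sup f g : fblFin := FBLFin p1 (fin_sup (valP f) (valP g)).
Definition fblFin_inf f g : fblFin := FBLFin p1 (fin_inf (valP f) (valP g)).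

Let fin_le_refl f : fblFin_le f f. Proof. exact: vle_refl. Qed.
Let fin_le_anti f g : fblFin_le f g -> fblFin_le g f -> f = g.
Proof. by move=> fg gf; apply/val_inj/vle_anti. Qed.
Let fin_le_trans g f h : fblFin_le f g -> fblFin_le g h -> fblFin_le f h.
Proof. exact: vle_trans. Qed.
Let supP f g h : fblFin_le (fblFin_sup f g) h <-> fblFin_le f h /\ fblFin_le g h.
Proof. exact: vsupP. Qed.
Let infP f g h : fblFin_le h (fblFin_inf f g) <-> fblFin_le h f /\ fblFin_le h g.
Proof. exact: vinfP. Qed.
Let leD2r h f g : fblFin_le f g -> fblFin_le (f + h) (g + h).
Proof. exact: vleD2r. Qed.
Let le_scale (a : R) f : 0 <= a -> fblFin_le 0 f -> fblFin_le 0 (a *: f).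
Proof. exact: vle_scale. Qed.

HB.instance Definition _ := Lmodule_isVectorLattice.Build R fblFin
  fin_le_refl fin_le_anti fin_le_trans supP infP leD2r le_scale.

Definition fblFin_norm f : R := fine (fbl_norm p f).

Lemma fblFin_normE f : (fblFin_norm f)%:E = fbl_norm p f.
Proof.
rewrite /fblFin_norm fineK// ge0_fin_numE ?fbl_norm_ge0//.
by have := valP f; rewrite inE.
Qed.

Let normD f g : fblFin_norm (f + g) <= fblFin_norm f + fblFin_norm g.
Proof. by rewrite -lee_fin EFinD !fblFin_normE; exact: (fbl_normD p1 f g). Qed.

Let norm_leZ (a : R) f : fblFin_norm (a *: f) <= `|a| * fblFin_norm f.
Proof. by rewrite -lee_fin EFinM !fblFin_normE; exact: (fbl_norm_leZ p1 a f). Qed.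

Let norm_ge0 f : 0 <= fblFin_norm f.
Proof. by rewrite fine_ge0// fbl_norm_ge0. Qed.

Let normZ (a : R) f : fblFin_norm (a *: f) = `|a| * fblFin_norm f.
Proof.
apply/eqP; rewrite eq_le norm_leZ/=.
have [->|a0] := eqVneq a 0; first by rewrite normr0 mul0r.
rewrite -ler_pdivlMl ?normr_gt0// -normfV.
by rewrite (le_trans _ (norm_leZ _ _))// scalerK.
Qed.

Lemma fblFin_eval_le f (phi : dual E) : `|f phi| <= `|phi| * fblFin_norm f.
Proof.
have [->|phi0] := eqVneq phi 0.
  have -> : f 0 = 0 by rewrite -(scale0r (0 : dual E)) posHomP// mul0r.
  by rewrite !normr0 mul0r.
rewrite -ler_pdivrMl ?normr_gt0// -[`|phi|^-1]ger0_norm// -normrM.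
rewrite -posHomP// -lee_fin fblFin_normE fbl_norm_ubound//.
by rewrite normrZ normfV normr_id mulVf ?normr_eq0.
Qed.

Let norm0_eq0 f : fblFin_norm f = 0 -> f = 0.
Proof.
move=> f0; apply/val_inj/val_inj/funext => phi; apply/eqP.
by rewrite -normr_le0 (le_trans (fblFin_eval_le f phi))// f0 mulr0.
Qed.

HB.instance Definition _ := Lmodule_isNormed.Build R fblFin normD normZ norm0_eq0.

Lemma fblFin_normrE f : `|f|%:E = fbl_norm p f.
Proof. exact: fblFin_normE. Qed.

Let complete (F : set_system fblFin) : ProperFilter F -> cauchy F -> cvg F.
Proof.
move=> FF /cauchyP Fc.
have Fphi (phi : dual E) : cauchy ((fun f : fblFin => f phi : R) @ F).
  apply/cauchyP => e e0.
  have [f Ff] := Fc (e / (`|phi| + 1)) (divr_gt0 e0 (ltr_wpDl (normr_ge0 _) ltr01)).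
  exists (f phi); rewrite /=; apply: filterS Ff => g.
  rewrite /preimage/= -!ball_normE/= => fg.
  have := fblFin_eval_le (f - g) phi; move=> /le_lt_trans; apply.
  rewrite ltr_pdivlMr ?ltr_wpDl// in fg; apply: le_lt_trans fg.
  by rewrite mulrC ler_wpM2l// lerDl.
pose l (phi : dual E) : R := lim ((fun f : fblFin => f phi : R) @ F).
have Fl phi : (fun f : fblFin => f phi : R) @ F --> l phi.
  exact: (@cauchy_cvg R _ _ (Fphi phi)).
have lh : (l : dual E -> R^o) \in positively_homogeneous (E := E).
  apply/asboolP => a phi a0.
  have H : (fun f : fblFin => f (a *: phi) : R) @ F --> a * l phi.
    rewrite (_ : (fun f : fblFin => _) = (fun f : fblFin => a * (f phi : R))).
      by apply: cvgMr; exact: Fl.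
    by apply/funext => f; rewrite posHomP.
  exact: (cvg_unique (@Rhausdorff R) (Fl (a *: phi)) H).
have near_l f e : F (ball f e) ->
    (fbl_norm p (fun phi => l phi - f phi)%R <= e%:E)%E.
  move=> Fe; apply: (@fbl_norm_lim R E p p1 fblFin F (fun g phi => g phi) l f e FF Fl).
  apply: filterS Fe => g.
  rewrite -ball_normE/= distrC => /ltW; rewrite -lee_fin; apply: le_trans.
  by rewrite fblFin_normrE.
have lf : PosHom lh \in fbl_finite.
  have [f Ff] := Fc 1 ltr01.
  rewrite inE; apply: (@le_lt_trans _ _ (1%:E + fbl_norm p f)%E); last first.
    by apply: lte_add_pinfty; [exact: ltry|have := valP f; rewrite inE].
  apply: le_trans (leeD (near_l _ _ Ff) (lexx _)).
  apply: le_trans (fbl_normD p1 _ _); apply: le_fbl_norm => // phi.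
  by rewrite subrK.
apply/cvg_ex; exists (FBLFin p1 lf).
move=> B /nbhs_normP[e /= e0 eB].
have [f Ff] := Fc (e / 2) (divr_gt0 e0 (ltr0n _ 2)).
apply: filterS (Ff) => g fg; apply: eB => /=.
rewrite -(subrK f (FBLFin p1 lf)) -addrA (le_lt_trans (ler_normD _ _))//.
have {}fg : `|f - g| < e / 2 by move: fg; rewrite -ball_normE.
rewrite [ltRHS]splitr ler_ltD//.
by rewrite -lee_fin fblFin_normrE; exact: near_l.
Qed.

HB.instance Definition _ := Uniform_isComplete.Build fblFin complete.

Let norm_vabs_le f g : vle (vabs f) (vabs g) -> `|f| <= `|g|.
Proof.
move=> fg; rewrite -lee_fin !fblFin_normrE.
apply: le_fbl_norm => // phi; rewrite -!posHom_absE; exact: fg phi.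
Qed.

HB.instance Definition _ :=
  NormedVectorLattice_isBanachLattice.Build R fblFin norm_vabs_le.

Definition fbl_delta (x : E) : fblFin := FBLFin p1 (eval_fin x).

End FiniteFBLNorm.

Definition FBL (R : realType) (E : normedModType R) (p : \bar R) (p1 : (1 <= p)%E) :
    banachLatticeType R :=
  closed_sublattice (range (fbl_delta (E := E) p1)).

Definition isomorphic_embedding (R : realType) (V W : normedModType R) (T : V -> W) :=
  exists c C : R, [/\ 0 < c, 0 < C & forall x, c * `|x| <= `|T x| <= C * `|x|].

(* Main.v *)
(** Restricting functions to the dual ball [B] turns FBL^(p)[E] into a space of
    weak*-continuous functions, and E embeds isometrically into FBL^(oo)[E] by
    Hahn-Banach. If [K] is weakly compact and generates FBL^(p)[E] as a lattice,
    its image in FBL^(oo)[E] is compact for pointwise convergence on [B], and the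
    closed sublattice [X] it generates there contains a copy of E. The space [X] is
    WCG: bounded pieces of [K] and their iterated lattice combinations are again
    pointwise compact and bounded, and shrinking these countably many sets to a null
    sequence yields one bounded pointwise compact set with dense span. On such a
    set the pointwise and the weak topology agree: by Whitley's form of the
    Eberlein-Smulian argument a pointwise limit is the limit of a sequence, and by
    Simons' argument a functional cannot separate a bounded pointwise null
    sequence from 0. *)
From HB Require Import structures.
Require Import Defs.
From mathcomp Require Import all_boot all_order all_algebra.
From mathcomp Require Import all_classical all_reals all_analysis.
From mathcomp Require Import ring lra.

Set Implicit Arguments.
Unset Strict Implicit.
Unset Printing Implicit Defensive.

Import Order.TTheory GRing.Theory Num.Theory.
Import numFieldNormedType.Exports.

Local Open Scope classical_set_scope.
Local Open Scope ring_scope.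

(** * Norm-attaining families of functionals *)

Lemma near_best_point (R : realType) (X : normedModType R) (A : set X) (h : X)
    (t d : R) : A !=set0 -> 0 < d ->
  exists2 g, A g & forall y, A y -> `|h + t *: g| <= `|h + t *: y| + d.
Proof.
move=> [a Aa] d0; pose S := [set `|h + t *: y| | y in A].
have hS : has_inf S.
  by split; [exists `|h + t *: a|, a|exists 0 => _ [y _ <-]].
have [_ [g Ag <-] gS] := inf_adherent d0 hS.
exists g => // y Ay; rewrite (le_trans (ltW gS))// lerD2r.
by apply: ge_inf; [case: hS|exists y].
Qed.

Lemma cvg_geometric_combination (R : realType) (X : completeNormedModType R)
    (g : nat -> X) (lam : R) : 0 < lam < 1 -> (forall n, `|g n| <= 1) ->
  exists h : X, forall n,
    `|h - \sum_(k < n) lam ^+ k *: g k| <= lam ^+ n / (1 - lam).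
Proof.
move=> /andP[l0 l1] g1; pose u k := lam ^+ k *: g k.
have u_le k : `|u k| <= lam ^+ k.
  rewrite normrZ ger0_norm ?exprn_ge0 ?(ltW l0)//.
  by rewrite ler_piMr ?exprn_ge0 ?(ltW l0).
have cu : cvgn (series u).
  apply: normed_cvg.
  apply: (series_le_cvg _ _ _ (is_cvg_geometric_series (a := 1) (z := lam) _)).
  - by move=> n; exact: normr_ge0.
  - by move=> n; rewrite /= mul1r exprn_ge0 ?ltW.
  - by move=> n; rewrite /= mul1r.
  - by rewrite ger0_norm ?ltW.
exists (limn (series u)) => n; rewrite -(big_mkord xpredT u).
have cun : (fun m => `|series u m - series u n|) @ \oo -->
    `|limn (series u) - series u n|.
  by apply: cvg_norm; apply: cvgB => //; exact: cvg_cst.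
rewrite -/(series u n) -(cvg_lim _ cun)//.
apply: limr_le; first by apply/cvg_ex; eexists; exact: cun.
near=> m; have nm : (n <= m)%N by near: m; exists n.
rewrite sub_series_geq// (le_trans (ler_norm_sum _ _ _))//.
apply: (@le_trans _ _ (\sum_(n <= k < m) lam ^+ k)); first exact: ler_sum.
rewrite -(subnKC nm) geometric_partial_tail.
by rewrite geometric_le_lim// ?exprn_ge0 ?ltW// ger0_norm ?ltW.
Unshelve. all: end_near. Qed.

Section NormAttainingFamily.
Variables (R : realType) (X : completeNormedModType R) (L : Type).
Variable ev : L -> X -> R.
Hypothesis ev_linear : forall l a x y, ev l (a *: x + y) = a * ev l x + ev l y.
Hypothesis ev_le : forall l x, `|ev l x| <= `|x|.
Hypothesis ev_attained : forall x, exists l, `|ev l x| = `|x|.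

Lemma evD l x y : ev l (x + y) = ev l x + ev l y.
Proof. by rewrite -[x]scale1r ev_linear mul1r scale1r. Qed.

Lemma ev0 l : ev l 0 = 0.
Proof. by apply: (addrI (ev l 0)); rewrite -evD !addr0. Qed.

Lemma evZ l a x : ev l (a *: x) = a * ev l x.
Proof. by rewrite -[a *: x]addr0 ev_linear ev0 addr0. Qed.

Lemma evB l x y : ev l (x - y) = ev l x - ev l y.
Proof. by rewrite -scaleN1r addrC ev_linear mulN1r addrC. Qed.

(** Attainment makes [L] a boundary: bounds valid at every index pass to the norm. *)
Lemma norm_le_ev x c : (forall l, `|ev l x| <= c) -> `|x| <= c.
Proof. by move=> h; have [l <-] := ev_attained x. Qed.

Lemma ev_inj x y : (forall l, ev l x = ev l y) -> x = y.
Proof.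
move=> xy; apply/eqP; rewrite -subr_eq0 -normr_le0; apply: norm_le_ev => l.
by rewrite evB xy subrr normr0.
Qed.

(* Simons' argument: pick [g n] in [C n] nearly minimizing
   [`|\sum_(k <= n) lam ^+ k *: g k|] and take [l] attaining the norm of the
   infinite sum [h]; as [h] minus a partial sum is a multiple of a convex
   combination [u n] of later terms, no [ev l (g n)] can be small. *)
Lemma simons (C : nat -> set X) (e : R) :
  0 < e -> (forall n, C n.+1 `<=` C n) -> (forall n, C n !=set0) ->
  (forall n x y (t : R), 0 <= t <= 1 -> C n x -> C n y ->
    C n (t *: x + (1 - t) *: y)) ->
  (forall x, C 0 x -> e <= `|x| <= 1) ->
  exists l (g : nat -> X), forall n, C n (g n) /\ e / 2 <= `|ev l (g n)|.
Proof.
move=> e0 Cdec C0 Cconv Ce.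
have Cle m n : (m <= n)%N -> C n `<=` C m.
  by move/subnK => <-; elim: (n - m)%N => // k IH; apply: subset_trans IH; exact: Cdec.
have C1 n x : C n x -> e <= `|x| <= 1 by move/(Cle _ _ (leq0n n)); exact: Ce.
have e1 : e <= 1.
  by have [x /Ce/andP[ex x1]] := C0 0; exact: le_trans ex x1.
(* The tail after [g n], divided by [lam ^+ n], is at most [lam / (1 - lam) <= e / 4]. The errors
   [d n], divided by [lam ^+ n.+1], add up to at most [eta = e / 4]. Out of [s >= e] this leaves
   [e / 2]. *)
pose lam := e / 8; have l0 : 0 < lam by rewrite /lam; lra.
have l1 : lam < 1 by rewrite /lam; lra.
have l1' : 0 < 1 - lam by rewrite subr_gt0.
have le01 : 0 <= lam <= 1 by rewrite !ltW.
pose eta := e / 4; have eta0 : 0 < eta by rewrite /eta; lra.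
pose d n := eta * lam ^+ n.+1 / 2 ^+ n.+1.
have d0 n : 0 < d n by rewrite /d divr_gt0 ?mulr_gt0 ?exprn_gt0.
have /choice[G GP] (nh : nat * X) : exists g, C nh.1 g /\ forall y, C nh.1 y ->
    `|nh.2 + lam ^+ nh.1 *: g| <= `|nh.2 + lam ^+ nh.1 *: y| + d nh.1.
  by have [g] := near_best_point nh.2 (lam ^+ nh.1) (C0 nh.1) (d0 nh.1); exists g.
pose H := fix H n := if n is m.+1 then H m + lam ^+ m *: G (m, H m) else 0.
pose g n := G (n, H n).
have gC n : C n (g n) by have [] := GP (n, H n).
have Hmin n y : C n y -> `|H n.+1| <= `|H n + lam ^+ n *: y| + d n.
  by have [_] := GP (n, H n); apply.
have g1 n : `|g n| <= 1 by have /C1/andP[] := gC n.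
have HE n : H n = \sum_(k < n) lam ^+ k *: g k.
  by elim: n => [|n IH]; rewrite ?big_ord0// big_ord_recr -IH.
have [h hH'] := cvg_geometric_combination (introT andP (conj l0 l1)) g1.
have hH n : `|h - H n| <= lam ^+ n / (1 - lam) by rewrite HE.
(* The tail of the series from [n] on, normalized so that its weights sum to 1. *)
pose u n := ((1 - lam) / lam ^+ n) *: (h - H n).
have ln n : 0 < lam ^+ n by rewrite exprn_gt0.
have uE n : u n = (1 - lam) *: g n + lam *: u n.+1.
  rewrite /u (_ : H n.+1 = H n + lam ^+ n *: g n)// scalerA.
  have -> : lam * ((1 - lam) / lam ^+ n.+1) = (1 - lam) / lam ^+ n.
    by rewrite exprS; field; rewrite !gt_eqF.
  rewrite opprD addrA [in RHS]scalerBr scalerA divfK ?gt_eqF//.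
  by rewrite [RHS]addrC subrK.
have u1 n : `|u n| <= 1.
  rewrite /u normrZ ger0_norm; last by rewrite divr_ge0 ?ltW.
  rewrite (le_trans (ler_wpM2l _ (hH n)))//; first by rewrite divr_ge0 ?ltW.
  suff -> : (1 - lam) / lam ^+ n * (lam ^+ n / (1 - lam)) = 1 by [].
  by field; rewrite !gt_eqF.
(* [C n] need not be closed, so [u n] is only approximated from it: unroll [uE] [m] times, then
   replace the remaining [u] by a [g]. *)
have uC m n : exists2 y, C n y & `|u n - y| <= 2 * lam ^+ m.
  elim: m n => [|m IH] n.
    exists (g n) => //; rewrite (le_trans (ler_normB _ _))// expr0.
    by have := u1 n; have := g1 n; lra.
  have [y Cy uy] := IH n.+1.
  exists ((1 - lam) *: g n + (1 - (1 - lam)) *: y).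
    by apply: Cconv; [lra|exact: gC|exact: Cdec].
  rewrite uE opprD addrACA subrr add0r subKr -scalerBr normrZ gtr0_norm//.
  by rewrite exprS mulrCA ler_wpM2l// ltW.
have lim0 (c : R) : 0 < c -> exists m, 2 * lam ^+ m <= c.
  move=> c0; have c20 : 0 < c / 2 by rewrite divr_gt0.
  have := @cvg_geometric R 1 lam; rewrite ger0_norm ?ltW// => /(_ l1).
  move=> /cvgrPdist_le/(_ _ c20)[m _ /(_ m (leqnn m))].
  rewrite /= sub0r normrN mul1r ger0_norm ?(ltW (ln m))// => hm.
  by exists m; lra.
have Hu n : `|H n.+1| <= `|H n + lam ^+ n *: u n| + d n.
  apply/ler_addgt0Pr => c c0; have [m mc] := lim0 _ c0.
  have [y Cy uy] := uC m n; rewrite (le_trans (Hmin _ _ Cy))// addrAC lerD2r.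
  have -> : H n + lam ^+ n *: y = (H n + lam ^+ n *: u n) - lam ^+ n *: (u n - y).
    by rewrite scalerBr opprB addrACA subrr addr0.
  rewrite (le_trans (ler_normB _ _))// lerD2l normrZ gtr0_norm//.
  rewrite (le_trans _ mc)// (le_trans _ uy)// ler_piMl//.
  by rewrite exprn_ile1 ?ltW.
(* This point lies on the segment from [h] to [H n], so near minimality bounds the norm of [H n.+1]
   by a convex combination of [s] and the norm of [H n], up to [d n]. *)
have HuE n : H n + lam ^+ n *: u n = (1 - lam) *: h + lam *: H n.
  rewrite /u scalerA mulrCA mulfV ?gt_eqF// mulr1 scalerBr addrCA.
  by rewrite -{1}[H n]scale1r -scalerBl subKr.
pose s := `|h|.
have sH n : `|H n.+1| <= (1 - lam) * s + lam * `|H n| + d n.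
  apply: (le_trans (Hu n)); rewrite HuE lerD2r.
  by rewrite (le_trans (ler_normD _ _))// !normrZ !gtr0_norm.
have es : e <= s.
  have : e <= `|u 0%N|.
    apply/ler_addgt0Pr => c c0; have [m mc] := lim0 _ c0.
    have [y /C1/andP[ey _] uy] := uC m 0%N.
    rewrite (le_trans ey)// -[y](subKr (u 0%N)) (le_trans (ler_normB _ _))//.
    by rewrite lerD2l (le_trans uy).
  rewrite /u expr0 divr1 subr0 normrZ gtr0_norm// => /le_trans; apply.
  by rewrite ler_piMl// /s; lra.
have Hs n : lam ^+ n * (s - eta * (1 - 2 ^- n)) <= s - `|H n|.
  elim: n => [|n IH]; first by rewrite /= !expr0 invr1 subrr normr0; lra.
  have := sH n; have := ler_wpM2l (ltW l0) IH; rewrite /d.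
  have -> : eta * lam ^+ n.+1 / 2 ^+ n.+1 = lam * lam ^+ n * eta * (2^-1 * 2 ^- n).
    by rewrite !exprS invfM; ring.
  have -> : 2 ^- n.+1 = 2^-1 * 2 ^- n :> R by rewrite exprS invfM.
  rewrite [lam ^+ n.+1]exprS.
  move: (lam ^+ n) (2 ^- n) (`|H n|) (`|H n.+1|) => a b c c' h1 h2.
  by lra.
have [l hl] := ev_attained h; exists l, g => n; split => //.
have A1 : s - eta <= (s - `|H n|) / lam ^+ n.
  rewrite ler_pdivlMr// mulrC (le_trans _ (Hs n))// ler_wpM2l ?(ltW (ln n))//.
  by rewrite lerD2l lerN2 ler_piMr ?(ltW eta0) //.
have A2 : lam ^+ n.+1 / (1 - lam) / lam ^+ n <= e / 4.
  have -> : lam ^+ n.+1 / (1 - lam) / lam ^+ n = lam / (1 - lam).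
    by rewrite exprS; field; rewrite !gt_eqF.
  by rewrite ler_pdivrMr// /lam; nra.
have A3 : s <= `|H n| + lam ^+ n * `|ev l (g n)| + lam ^+ n.+1 / (1 - lam).
  rewrite /s -hl.
  have -> : h = H n + lam ^+ n *: g n + (h - H n.+1) by rewrite addrC subrK.
  rewrite evD [ev l (H n + _)]evD evZ (le_trans (ler_normD _ _))// lerD ?(le_trans (ev_le _ _))//.
  rewrite (le_trans (ler_normD _ _))// lerD//.
  by rewrite normrM gtr0_norm.
have : (s - `|H n|) / lam ^+ n <= `|ev l (g n)| + lam ^+ n.+1 / (1 - lam) / lam ^+ n.
  rewrite ler_pdivrMr// mulrDl divfK ?gt_eqF// [_ * lam ^+ n]mulrC.
  by rewrite lerBlDl addrA.
by move: A1 A2; rewrite /eta; lra.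
Qed.

End NormAttainingFamily.

(** * Pointwise compactness *)

Lemma fmap_ultra (T U : Type) (f : T -> U) (F : set_system T) :
  UltraFilter F -> UltraFilter (f @ F).
Proof.
move=> FU; split=> [|G GF FG]; first exact: fmap_proper_filter.
rewrite eqEsubset; split=> // A GA; have [//|FA] := in_ultra_setVsetC (f @^-1` A) FU.
have /filter_ex[? []//] : G (A `&` ~` A) by apply: filterI => //; exact: FG.
Qed.

Lemma ultraU (T : Type) (F : set_system T) (A B : set T) :
  UltraFilter F -> F (A `|` B) -> F A \/ F B.
Proof.
move=> FU FAB; have [|FA] := in_ultra_setVsetC A FU; first by left.
by right; apply: filterS (filterI FAB FA) => x [[]].
Qed.

(* Compactness, in terms of ultrafilters, for the initial topology of the
   functions [ev i]. *)
Definition ptcompact (R : realType) (I Y : Type) (ev : I -> Y -> R) (K : set Y) :=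
  forall F : set_system Y, UltraFilter F -> F K ->
    exists2 y, K y & forall i, ev i @ F --> ev i y.

Lemma cvg_initial (S : choiceType) (T : topologicalType) (f : S -> T)
    (F : set_system S) (x : S) :
  Filter F -> f @ F --> f x -> F --> (x : initial_topology f).
Proof.
move=> FF Ff B; rewrite nbhsE => -[_ [[C Co <-] Cx] CB].
by apply: filterS CB _; apply: Ff; exact: open_nbhs_nbhs.
Qed.

Lemma weak_cvgP (R : realType) (V : normedModType R) (F : set_system V) (x : V) :
  Filter F ->
  F --> (x : initial_topology (@weak_eval R V)) <->
  forall phi : dual V, (phi : V -> R) @ F --> (phi x : R).
Proof.
move=> FF; split=> [Fx phi|Fphi].
  have c1 := @initial_continuous _ _ (@weak_eval R V) x.
  have c2 := @proj_continuous _ (fun _ : dual V => R : topologicalType) phi (weak_eval x).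
  have := cvg_trans (cvg_app (@weak_eval R V) Fx) c1.
  by move=> /(cvg_app (proj phi))/cvg_trans; apply; exact: c2.
apply: cvg_initial; apply/cvg_sup => phi; apply: cvg_initial.
exact: Fphi.
Qed.

Lemma weakly_compactP (R : realType) (V : normedModType R) (K : set V) :
  weakly_compact K <-> ptcompact (fun (phi : dual V) x => phi x : R) K.
Proof.
rewrite /weakly_compact compact_ultra; split=> KC F FU FK.
  by have [x [Kx /weak_cvgP Fx]] := KC F FU FK; exists x.
by have [x Kx Fx] := KC F FU FK; exists x; split => //; apply/weak_cvgP.
Qed.

Section PointwiseCompactness.
Variables (R : realType) (X : completeNormedModType R) (L : eqType).
Variable ev : L -> X -> R.
Hypothesis ev_linear : forall l a x y, ev l (a *: x + y) = a * ev l x + ev l y.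
Hypothesis ev_le : forall l x, `|ev l x| <= `|x|.
Hypothesis ev_attained : forall x, exists l, `|ev l x| = `|x|.
Hypothesis ev_compact : ptcompact (fun x l => ev l x) [set: L].

(** Total boundedness in finitely many coordinates, by induction on [s]: cut the range of [ev l x]
    into cells of length [e] and take a net of the part of [A] over each cell. Net points are
    required to lie in [A] so that they stay in their cell. *)
Lemma finite_net (s : seq X) (e : R) : 0 < e -> forall A : set L,
  exists P : seq L, forall l, A l ->
    exists p, [/\ p \in P, A p & forall x, x \in s -> `|ev l x - ev p x| < e].
Proof.
move=> e0; elim: s => [|x s IH] A.
  have [[l0 Al0]|A0] := pselect (A !=set0).
    by exists [:: l0] => l _; exists l0; rewrite ?mem_head.
  by exists [::] => l Al; case: A0; exists l.
pose v l := (ev l x + `|x|) / e; pose c l := Num.truncn (v l).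
have v0 l : 0 <= v l.
  by rewrite divr_ge0 ?(ltW e0)//; have /ler_normlP[] := ev_le l x; lra.
have /choice[P hP] := fun j => IH (A `&` [set l | c l = j]).
pose N := (Num.truncn ((`|x| + `|x|) / e)).+1.
exists (flatten [seq P j | j <- iota 0 N]) => l Al.
have [p [pP [Ap cp] hp]] := hP (c l) l (conj Al erefl).
exists p; split => //.
  apply/flatten_mapP; exists (c l) => //; rewrite mem_iota add0n ltnS/=.
  apply: le_truncn; rewrite ler_pM2r ?invr_gt0// lerD2r.
  by rewrite (le_trans (ler_norm _)).
move=> y; rewrite inE => /predU1P[->|]; last exact: hp.
have /andP[a1 a2] := truncn_itv (v0 l).
have /andP[b1 b2] := truncn_itv (v0 p).
rewrite -/(c l) -/(c p) cp -natr1 in a1 a2 b1 b2.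
have -> : ev l x - ev p x = (v l - v p) * e.
  by rewrite /v; field; rewrite gt_eqF.
rewrite normrM (gtr0_norm e0) -{2}[e]mul1r ltr_pM2r// ltr_norml.
by apply/andP; split; lra.
Qed.

(* The finite sets [P n] are increasingly fine nets of [L] for the first [n]
   terms of the sequence, on which all later terms are close to [h]. *)
Lemma whitley_sequence (F : set_system X) (A : set X) (h : X) :
  Filter F -> F `<=` nonempty -> F A -> (forall l, ev l @ F --> ev l h) ->
  exists (f : nat -> X) (P : nat -> seq L),
    [/\ forall n, A (f n),
        forall n p, p \in P n -> forall k, (n <= k)%N ->
          `|ev p (f k) - ev p h| < k.+1%:R^-1 &
        forall n l, exists2 p, p \in P n.+1 &
          `|ev l h - ev p h| < n.+1%:R^-1 /\
          forall i, (i <= n)%N -> `|ev l (f i) - ev p (f i)| < n.+1%:R^-1].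
Proof.
move=> FF F0 FA Fh.
(* The state holds the terms chosen so far, latest first, and the accumulated net. A step picks a
   term close to [h] on that net, then a net for [h], the new term and all earlier ones. *)
have /choice[N hN] (st : seq X * seq L) : exists gP : X * seq L,
    [/\ A gP.1, forall p, p \in st.2 ->
          `|ev p gP.1 - ev p h| < (size st.1).+1%:R^-1 &
        forall l, exists2 p, p \in gP.2 & forall x, x \in h :: gP.1 :: st.1 ->
          `|ev l x - ev p x| < (size st.1).+1%:R^-1].
  have n0 : 0 < (size st.1).+1%:R^-1 :> R by rewrite invr_gt0.
  have [g [Ag gP]] : (A `&` [set g | forall p, p \in st.2 ->
      `|ev p g - ev p h| < (size st.1).+1%:R^-1]) !=set0.
    apply: F0; apply: filterI => //; elim: st.2 => [|p s IH]; first exact: filterE.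
    have /cvgrPdist_lt/(_ _ n0) Fp := Fh p.
    apply: filterS (filterI Fp IH) => x [/= xp xs] q.
    by rewrite inE => /predU1P[->|/xs//]; rewrite distrC.
  have [P hP] := finite_net (h :: g :: st.1) n0 setT.
  by exists (g, P); split => // l; have [p [pP _ hp]] := hP l I; exists p.
pose st := fix st n := if n is m.+1
  then ((N (st m)).1 :: (st m).1, (N (st m)).2 ++ (st m).2) else ([::], [::]).
have size_st n : size (st n).1 = n by elim: n => //= n ->.
have st1 n i : (i < n)%N -> (N (st i)).1 \in (st n).1.
  elim: n => // n IH; rewrite ltnS leq_eqVlt inE => /predU1P[->|/IH ->].
    by rewrite eqxx.
  by rewrite orbT.
have st2 n m p : (n <= m)%N -> p \in (st n).2 -> p \in (st m).2.
  move=> /subnK <- pn; elim: (m - n)%N => // k IH.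
  by rewrite addSn /= mem_cat IH orbT.
exists (fun n => (N (st n)).1), (fun n => (st n).2); split.
- by move=> n; have [] := hN (st n).
- move=> n p pn k nk; have [_ h2 _] := hN (st k).
  by have := h2 _ (st2 _ _ _ nk pn); rewrite size_st.
- move=> n l; have [_ _ /(_ l)[p pP h3]] := hN (st n); rewrite size_st in h3.
  exists p; first by rewrite /= mem_cat pP.
  split; first by apply: h3; rewrite mem_head.
  move=> i; rewrite leq_eqVlt => /predU1P[->|/st1 hi]; apply: h3.
    by rewrite !inE eqxx orbT.
  by rewrite !inE hi !orbT.
Qed.

(** Interchange of limits. If [ev l (f (k n))] stays away from [ev l h], choose net points [p n]
    approximating [l], and limits [y] of [p] and [g] of [f \o k] along one ultrafilter. Then [ev y]
    agrees with [ev l] at every [f i], hence at [g], and at [h]. No [p n] distinguishes [g] from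
    [h], so neither does [y]. Thus [ev l g = ev l h], a contradiction. *)
Lemma whitley (H A : set X) (F : set_system X) (h : X) :
  ptcompact ev H -> A `<=` H -> Filter F -> F `<=` nonempty -> F A ->
  (forall l, ev l @ F --> ev l h) ->
  exists2 f : nat -> X, (forall n, A (f n)) &
    forall l, (fun n => ev l (f n)) @ \oo --> ev l h.
Proof.
move=> Hc AH FF F0 FA Fh.
have [f [P [Af fP Pnet]]] := whitley_sequence FF F0 FA Fh.
exists f => // l; apply/cvgrPdist_lt => e e0; apply: contrapT => ncvg.
have /choice[k hk] n : exists k, (n <= k)%N /\ e <= `|ev l h - ev l (f k)|.
  apply: contrapT => nk; apply: ncvg; exists n => // k /= nk'.
  by rewrite ltNge; apply/negP => ek; apply: nk; exists k.
have [U [UU Uoo]] := ultraFilterLemma eventually_filter.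
have small n0 (a : nat -> R) (c : R) :
    (forall n, (n0 <= n)%N -> `|c - a n| < n.+1%:R^-1) -> a @ U --> c.
  move=> ac; apply: cvg_trans (cvg_app a Uoo) _; apply/cvgrPdist_lt => d d0.
  have /cvgrPdist_lt/(_ d d0)[n1 _ hn1] := @cvg_harmonic R.
  exists (maxn n0 n1) => // n /=; rewrite geq_max => /andP[n0n /hn1].
  by rewrite /= sub0r normrN gtr0_norm ?invr_gt0//; exact/lt_trans/ac.
have /choice[p hp] n : exists p, [/\ p \in P n.+1,
    `|ev l h - ev p h| < n.+1%:R^-1 &
    forall i, (i <= n)%N -> `|ev l (f i) - ev p (f i)| < n.+1%:R^-1].
  by have [p pP [p1 p2]] := Pnet n l; exists p.
have [//|y _ Uy] := ev_compact (fmap_ultra p UU); first exact: filterT.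
have [|g Hg Ug] := Hc _ (fmap_ultra (f \o k) UU).
  by apply: (@filterE _ U) => n /=; exact/AH/Af.
have yf i : ev y (f i) = ev l (f i).
  apply: (cvg_unique (@Rhausdorff R) (Uy (f i))); apply: (small i) => n ni.
  by have [_ _] := hp n; apply.
have yg : ev y g = ev l g.
  apply: (cvg_unique (@Rhausdorff R) (Ug y)).
  rewrite (_ : ev y @ _ = ev l @ ((f \o k) @ U)); first exact: Ug.
  rewrite /fmap/=; congr (_ @ U); apply/funext => n; exact: yf.
have pg n : ev (p n) g = ev (p n) h.
  apply: (cvg_unique (@Rhausdorff R) (Ug (p n))); apply: (small n.+1) => m nm.
  rewrite distrC; have [pn _ _] := hp n; have [mk _] := hk m.
  apply: (lt_le_trans (fP _ _ pn _ (leq_trans nm mk))).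
  by rewrite lef_pV2 ?posrE// ler_nat.
have yh : ev y h = ev l h.
  apply: (cvg_unique (@Rhausdorff R) (Uy h)); apply: (small 0%N) => n _.
  by have [] := hp n.
have {}yh : ev l g = ev l h.
  rewrite -yg -yh; apply: (cvg_unique (@Rhausdorff R) (Uy g)).
  rewrite (_ : _ @ _ = (fun l => ev l h) @ (p @ U)); first exact: Uy.
  rewrite /fmap/=; congr (_ @ U); apply/funext => n; exact: pg.
have /cvgrPdist_lt/(_ _ e0) Ul := Ug l.
have [n /=] := @filter_ex _ U _ (fun n => `|ev l g - ev l (f (k n))| < e) Ul.
by have [_ ek] := hk n; rewrite yh ltNge ek.
Qed.

(** If [phi] does not follow a pointwise limit [h], [whitley] extracts a sequence that tends
    pointwise to [h] while [phi] stays [e] away from [phi h]. Applied to the tails of this sequence,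
    [simons] finds an index at which it does not tend to [h]. *)
Lemma ptcompact_weakly_compact (H : set X) (M : R) :
  (forall x, H x -> `|x| <= M) -> ptcompact ev H -> weakly_compact H.
Proof.
move=> HM Hc; apply/weakly_compactP => F FU FH.
have [h Hh Fh] := Hc F FU FH; exists h => // phi.
apply/cvgrPdist_lt => e e0.
have [//|nF] := in_ultra_setVsetC [set x | `|phi h - phi x| < e] FU.
exfalso.
(* The ultrafilter decides the sign of [phi (x - h)], and [psi] is [phi] or [- phi] accordingly. *)
have [psi [A [AH FA psiA]]] : exists (psi : dual X) A,
    [/\ A `<=` H, F A & forall x, A x -> e <= psi (x - h)].
  have : F ((H `&` [set x | e <= phi (x - h)]) `|` (H `&` [set x | e <= (- phi) (x - h)])).
    apply: filterS (filterI FH nF) => x [Hx /negP]; rewrite -leNgt distrC ler_normr -linearB.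
    by case/orP => hx; [left|right].
  case/ultraU => FA.
    by exists phi, (H `&` [set x | e <= phi (x - h)]); split => // x [].
  by exists (- phi), (H `&` [set x | e <= (- phi) (x - h)]); split => // x [].
have [f fA fh] := whitley Hc AH _ (@filter_ex _ F _) FA Fh.
have M0 : 0 <= M by apply: le_trans (HM _ Hh).
(* Differences of points of [H] have norm at most [2 * M], so this factor moves them into the unit
   ball. *)
pose c := (2 * M + 1)^-1; have c0 : 0 < c by rewrite invr_gt0; lra.
pose d n := c *: (f n - h).
have d1 n : `|d n| <= 1.
  rewrite normrZ gtr0_norm// /c ler_pdivrMl ?mulr1; last by lra.
  rewrite (le_trans (ler_normB _ _))//.
  by have := HM _ (AH _ (fA n)); have := HM _ Hh; lra.
have psid n : c * e <= psi (d n) by rewrite linearZ/= ler_pM2l// psiA.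
(* The bound [c * e <= psi y] forces norm at least [c * e / N], the lower bound that [simons] asks
   for; adding 1 keeps [N] positive. *)
pose N := `|psi| + 1; have N0 : 0 < N by rewrite ltr_wpDl.
(* [C n] contains the convex hull of the tail [d n, d n.+1, ...]. *)
pose C n := [set y | [/\ `|y| <= 1, c * e <= psi y & forall l b,
  (forall k, (n <= k)%N -> `|ev l (d k)| <= b) -> `|ev l y| <= b]].
have cvx (t a b m : R) : 0 <= t <= 1 -> a <= m -> b <= m -> t * a + (1 - t) * b <= m.
  by move=> /andP[t0 t1] am bm; nra.
have normcvx (t a b : R) : 0 <= t <= 1 -> `|t * a + (1 - t) * b| <= t * `|a| + (1 - t) * `|b|.
  move=> /andP[t0 t1]; rewrite (le_trans (ler_normD _ _))// !normrM.
  by rewrite (ger0_norm t0) [`|1 - t|]ger0_norm ?subr_ge0.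
have [|n y [y1 y2 y3]|n|n x y t t01 [x1 x2 x3] [y1 y2 y3]|x [x1 x2 _]|l [g lg]] :=
    simons ev_linear ev_le ev_attained (C := C) (e := c * e / N).
- by rewrite divr_gt0// mulr_gt0.
- split=> // l b hb; apply: y3 => k nk; apply: hb; exact: ltnW.
- by exists (d n); split => // l b; exact.
- split.
  + apply: norm_le_ev => // l; rewrite (evD ev_linear) !(evZ ev_linear).
    rewrite (le_trans (normcvx _ _ _ t01))//.
    by apply: cvx => //; exact: le_trans (ev_le _ _) _.
  + rewrite linearD !linearZ/= -lerN2 -[leLHS]mul1r.
    have := cvx t (- psi x) (- psi y) (- (c * e)) t01; rewrite !lerN2 => /(_ x2 y2).
    by rewrite !mulrN -opprD mul1r.
  + move=> l b hb; rewrite (evD ev_linear) !(evZ ev_linear) (le_trans (normcvx _ _ _ t01))//.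
    by apply: cvx => //; [exact: x3|exact: y3].
- rewrite x1 andbT ler_pdivrMr// (le_trans x2)// (le_trans (ler_norm _))//.
  rewrite (le_trans (le_dual_norm _ _))// mulrC ler_wpM2l//.
  by rewrite /N lerDl.
have dl : (fun n => ev l (d n)) @ \oo --> (0 : R).
  rewrite (_ : (fun _ => _) = (fun n => c * (ev l (f n) - ev l h))); last first.
    by apply/funext => n; rewrite /d (evZ ev_linear) (evB ev_linear).
  rewrite -(mulr0 c) -(subrr (ev l h)); apply: cvgMr; apply: cvgB; first exact: fh.
  exact: cvg_cst.
have q0 : 0 < c * e / N / 2 / 2 by rewrite !divr_gt0// mulr_gt0.
have /cvgrPdist_lt/(_ _ q0)[n _ hn] := dl.
have [[_ _ gl] gq] := lg n.
have : `|ev l (g n)| <= c * e / N / 2 / 2.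
  by apply: gl => k nk; have := hn k nk; rewrite /= sub0r normrN => /ltW.
move=> /(le_trans gq); rewrite leNgt ltr_pdivrMr// mulr2n mulrDr mulr1 ltrDl.
by rewrite divr_gt0// divr_gt0// mulr_gt0.
Qed.

End PointwiseCompactness.

(** * Lattices generated by pointwise compact sets *)

(** Push [F] forward along a section of [f] over the image of [D]. Compactness of a parametrized set
    can then be checked on its parameters. *)
Lemma ultra_lift (Y Z : Type) (f : Y -> Z) (D : set Y) (F : set_system Z) :
  UltraFilter F -> F (f @` D) ->
  exists G : set_system Y, [/\ UltraFilter G, G D & f @ G = F].
Proof.
move=> FU FD; have [_ [y0 _ _]] := filter_ex FD.
have /choice[s sP] z : exists y, (f @` D) z -> D y /\ f y = z.
  have [[y Dy yz]|nz] := pselect ((f @` D) z); first by exists y.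
  by exists y0.
have FDs : F (s @^-1` D) by apply: filterS FD => z /sP[].
exists (s @ F); split => //; first exact: fmap_ultra.
have PF : ProperFilter (f @ (s @ F)) by do 2!apply: fmap_proper_filter.
apply: (max_filter PF) => A FA.
have : F ((f \o s) @^-1` A); last by [].
by apply: filterS (filterI FA FD) => z [Az /sP[_ fz]]; rewrite /preimage/= fz.
Qed.

Lemma ultra_bounded_cvg (R : realType) (F : set_system R) (M : R) :
  UltraFilter F -> F [set t | `|t| <= M] -> exists2 t, `|t| <= M & F --> t.
Proof.
move=> FU FM; have := @segment_compact R (- M) M; rewrite compact_ultra => h.
have [|t [tM Ft]] := h F FU.
  by apply: filterS FM => t /=; rewrite in_itv/= ler_norml.
by exists t => //; move: tM; rewrite /= in_itv/= -ler_norml.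
Qed.

Section PtcompactOperations.
Variable R : realType.

Lemma ptcompactU (I Y : Type) (ev : I -> Y -> R) (A B : set Y) :
  ptcompact ev A -> ptcompact ev B -> ptcompact ev (A `|` B).
Proof.
move=> cA cB F FU /ultraU[FA|FB].
  by have [y Ay Fy] := cA F FU FA; exists y => //; left.
by have [y By Fy] := cB F FU FB; exists y => //; right.
Qed.

Lemma ptcompact_image (I J Y Z : Type) (ev : I -> Y -> R) (ev' : J -> Z -> R)
    (f : Y -> Z) (K : set Y) :
  (forall (G : set_system Y) y, Filter G -> (forall i, ev i @ G --> ev i y) ->
    forall j, (ev' j \o f) @ G --> ev' j (f y)) ->
  ptcompact ev K -> ptcompact ev' (f @` K).
Proof.
move=> fc cK F FU FK; have [G [GU GK <-]] := ultra_lift FU FK.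
by have [y Ky Gy] := cK G GU GK; exists (f y); [exists y|move=> j; exact: fc].
Qed.

End PtcompactOperations.

Section LatticeGenerated.
Variables (R : realType) (X : banachLatticeType R) (L : eqType).
Variable ev : L -> X -> R.
Hypothesis ev_linear : forall l a x y, ev l (a *: x + y) = a * ev l x + ev l y.
Hypothesis ev_sup : forall l x y, ev l (vsup x y) = Num.max (ev l x) (ev l y).
Hypothesis ev_le : forall l x, `|ev l x| <= `|x|.
Hypothesis ev_attained : forall x, exists l, `|ev l x| = `|x|.
Hypothesis ev_compact : ptcompact (fun x l => ev l x) [set: L].

Let evD := evD ev_linear.
Let evZ := evZ ev_linear.
Let ev_inj := ev_inj ev_linear ev_attained.

(** The norm is a maximum of moduli of evaluations, so closed balls are pointwise closed. *)
Lemma ptcompact_ball (K : set X) (r : R) :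
  ptcompact ev K -> ptcompact ev (K `&` [set x | `|x| <= r]).
Proof.
move=> cK F FU FKr; have [|y Ky Fy] := cK F FU; first by apply: filterS FKr => x [].
exists y => //; split => //; apply: (norm_le_ev ev_attained) => l.
have Fl : (fun x => `|ev l x|) @ F --> `|ev l y| by apply: cvg_norm; exact: Fy.
apply: (closed_cvg [set t | t <= r] (@closed_le R r) _ _ Fl).
by apply: filterS FKr => x [_]; exact/le_trans/ev_le.
Qed.

(** The factor [c n] brings [K n] into the ball of radius [n.+1%:R^-1]. An ultrafilter on [W]
    containing none of the scaled sets avoids the first [N] of them for each [N], hence converges to
    0; this is why 0 belongs to [W]. *)
Lemma ptcompact_scaled_union (K : nat -> set X) :
  (forall n, ptcompact ev (K n)) ->
  (forall n, exists M, forall x, K n x -> `|x| <= M) ->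
  exists2 c : nat -> R, (forall n, 0 < c n) &
    let W := [set x | x = 0 \/ exists n, ( *:%R (c n) @` K n) x] in
    ptcompact ev W /\ forall x, W x -> `|x| <= 1.
Proof.
move=> cK /choice[M KM]; pose c n := (n.+1%:R * (`|M n| + 1))^-1.
have c0 n : 0 < c n by rewrite invr_gt0 mulr_gt0// ltr_wpDl.
have cM n x : ( *:%R (c n) @` K n) x -> `|x| <= n.+1%:R^-1.
  move=> [y Ky <-]; rewrite normrZ gtr0_norm// /c invfM -mulrA ler_piMr//.
  rewrite ler_pdivrMl ?mulr1 ?ltr_wpDl//.
  by rewrite (le_trans (KM _ _ Ky))// (le_trans (ler_norm _))// lerDl.
exists c => // W; split; last first.
  move=> x [->|[n /cM xn]]; first by rewrite normr0.
  by rewrite (le_trans xn)// invf_le1// ler1n.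
move=> F FU FW.
have [[n Fn]|nF] := pselect (exists n, F ( *:%R (c n) @` K n)).
  have cc : ptcompact ev ( *:%R (c n) @` K n).
    apply: ptcompact_image (cK n) => G y FG Gy l.
    rewrite (_ : ev l \o _ = fun x => c n * ev l x); last by apply/funext => x; rewrite /= evZ.
    by rewrite evZ; apply: cvgMr; exact: Gy.
  by have [y Ky Fy] := cc F FU Fn; exists y => //; right; exists n.
exists 0; first by left.
move=> l; rewrite (ev0 ev_linear); apply/cvgrPdist_lt => e e0.
have /cvgrPdist_lt/(_ e e0)[N _ hN] := @cvg_harmonic R.
have FN : F [set x | forall n, (n < N)%N -> ~ ( *:%R (c n) @` K n) x].
  elim: N {hN} => [|N IH]; first exact: filterE.
  have FN : F (~` ( *:%R (c N) @` K N)).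
    by have [FN|//] := in_ultra_setVsetC ( *:%R (c N) @` K N) FU; case: nF; exists N.
  apply: filterS (filterI IH FN) => x [xN nx] n.
  by rewrite ltnS leq_eqVlt => /predU1P[->|/xN].
apply: filterS (filterI FW FN) => x [Wx xN]; rewrite /= sub0r normrN.
apply: le_lt_trans (ev_le _ _) _; case: Wx => [->|[n nx]]; first by rewrite normr0.
rewrite (le_lt_trans (cM _ _ nx))//.
have Nn : (N <= n)%N by rewrite leqNgt; apply/negP => /xN; apply.
by have := hN n Nn; rewrite /= sub0r normrN gtr0_norm ?invr_gt0.
Qed.

(** Coefficients are confined to [[-1, 1]] to preserve compactness and boundedness. Infima are left
    to negation and [vsup]. *)
Definition lattice_combination (A : set X) : set X :=
  [set z | exists x y a b c, [/\ A x, A y, `|a| <= 1 /\ `|b| <= 1, `|c| <= 1 &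
    z = a *: x + (b *: y + c *: vsup x y)]].

(** A continuous image of two copies of [A] and three of [[-1, 1]]: lift the ultrafilter to the
    parameters and take limits coordinatewise. *)
Lemma ptcompact_lattice_combination (A : set X) :
  ptcompact ev A -> ptcompact ev (lattice_combination A).
Proof.
move=> cA F FU FA.
pose f (t : (X * X) * (R * R * R)) :=
  t.2.1.1 *: t.1.1 + (t.2.1.2 *: t.1.2 + t.2.2 *: vsup t.1.1 t.1.2).
pose D : set ((X * X) * (R * R * R)) := [set t | [/\ A t.1.1, A t.1.2,
  `|t.2.1.1| <= 1 /\ `|t.2.1.2| <= 1 & `|t.2.2| <= 1]].
have [|G [GU GD <-]] := @ultra_lift _ _ f D F FU.
  apply: filterS FA => z [x [y [a [b [c [Ax Ay [a1 b1] c1 ->]]]]]].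
  by exists ((x, y), (a, b, c)).
have push (T : Type) (q : _ -> T) (B : set T) : (forall t, D t -> B (q t)) -> (q @ G) B.
  by move=> DB; have : G (q @^-1` B) by apply: filterS GD => t; exact: DB.
have [|x Ax Gx] := cA _ (fmap_ultra (fun t => t.1.1) GU).
  by apply: push => t [].
have [|y Ay Gy] := cA _ (fmap_ultra (fun t => t.1.2) GU).
  by apply: push => t [].
have [|a a1 Ga] := ultra_bounded_cvg (M := 1) (fmap_ultra (fun t => t.2.1.1) GU).
  by apply: push => t [_ _ []].
have [|b b1 Gb] := ultra_bounded_cvg (M := 1) (fmap_ultra (fun t => t.2.1.2) GU).
  by apply: push => t [_ _ []].
have [|c c1 Gc] := ultra_bounded_cvg (M := 1) (fmap_ultra (fun t => t.2.2) GU).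
  by apply: push => t [].
exists (a *: x + (b *: y + c *: vsup x y)); first by exists x, y, a, b, c.
move=> l; rewrite !evD !evZ ev_sup.
rewrite (_ : _ @ (f @ G) = (fun t => t.2.1.1 * ev l t.1.1 + (t.2.1.2 * ev l t.1.2 +
    t.2.2 * Num.max (ev l t.1.1) (ev l t.1.2))) @ G); last first.
  by rewrite /fmap/=; congr (_ @ G); apply/funext => t; rewrite /f !evD !evZ ev_sup.
apply: cvgD; first by apply: cvgM; [exact: Ga|exact: Gx].
apply: cvgD; first by apply: cvgM; [exact: Gb|exact: Gy].
apply: cvgM; first exact: Gc.
rewrite maxr_absE; under eq_fun do rewrite maxr_absE.
apply: cvgMl; apply: cvgD; first by apply: cvgD; [exact: Gx|exact: Gy].
by apply: cvg_norm; apply: cvgB; [exact: Gx|exact: Gy].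
Qed.

(** The cone [V] over the increasing levels [A n] is a sublattice containing [K], hence dense, and
    it lies in the span of the single compact set [W] assembled from rescaled levels. Each level
    takes in only a bounded piece of [K], so that all levels are bounded. *)
Theorem lattice_WCG (K : set X) :
  ptcompact ev K -> dense (sublattice_gen K) -> WCG X.
Proof.
move=> cK dK.
pose A := fix A n := if n is m.+1
  then lattice_combination (A m) `|` (K `&` [set x | `|x| <= m%:R]) else [set 0].
have cA n : ptcompact ev (A n).
  elim: n => [|n IH] /=.
    move=> F FU F0; exists 0 => // l; apply: cvg_near_cst.
    by apply: filterS F0 => x ->.
  by apply: ptcompactU; [exact: ptcompact_lattice_combination|exact: ptcompact_ball].
have bA n : exists M, forall x, A n x -> `|x| <= M.
  elim: n => [|n [M hM]]; first by exists 0 => x ->; rewrite normr0.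
  exists (Num.max (M + (M + M)) n%:R) => z.
  rewrite le_max => -[[x [y [a [b [c [Ax Ay [a1 b1] c1 ->]]]]]]|[_ ->]]; last first.
    by rewrite orbT.
  have n1 t w : `|t| <= 1 -> `|w| <= M -> `|t *: w| <= M.
    move=> t1 wM; rewrite normrZ (le_trans _ wM)// ler_piMl//.
  have sM : `|vsup x y| <= M.
    apply: (norm_le_ev ev_attained) => l; rewrite ev_sup.
    by rewrite maxEle; case: ifPn => _; rewrite (le_trans (ev_le _ _))// hM.
  apply/orP; left; apply: (le_trans (ler_normD _ _)); apply: lerD; first exact: n1 (hM _ Ax).
  apply: (le_trans (ler_normD _ _)); apply: lerD; first exact: n1 (hM _ Ay).
  exact: n1.
have AS n x : A n x -> A n.+1 x.
  move=> Ax; left; exists x, x, 1, 0, 0; rewrite normr1 normr0.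
  by split => //; rewrite scale1r !scale0r !addr0.
have Ale m n x : (m <= n)%N -> A m x -> A n x.
  by move=> /subnK <- Am; elim: (n - m)%N => // k IH; exact: AS.
have [c' c'0] := ptcompact_scaled_union cA bA.
set W := [set x | _] => -[cW W1].
pose V : set X := [set x | exists n r y, [/\ 0 <= r, A n y & x = r *: y]].
have Vlin (a : R) x y : V x -> V y -> V (a *: x + y).
  move=> [m [r [u [r0 Au ->]]]] [n [s [v [s0 Av ->]]]].
  (* [C] dominates both coefficients, so the quotients by [C] are admissible in
     [lattice_combination]; the 1 keeps [C] positive. *)
  pose N := maxn m n; pose C := `|a * r| + s + 1.
  have C0 : 0 < C by rewrite ltr_wpDl// addr_ge0.
  exists N.+1, C, ((a * r / C) *: u + (s / C) *: v); split; first exact: ltW.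
    left; exists u, v, (a * r / C), (s / C), 0; split => //.
    - by apply: Ale Au; exact: leq_maxl.
    - by apply: Ale Av; exact: leq_maxr.
    - rewrite !normrM normfV (gtr0_norm C0) !ler_pdivrMr// !mul1r -normrM (ger0_norm s0).
      by split; rewrite /C -addrA ?lerDl ?addr_ge0// addrCA lerDl addr_ge0.
    - by rewrite normr0.
    - by rewrite scale0r addr0.
  by rewrite scalerDr !scalerA ![C * _]mulrC !divfK ?gt_eqF.
have Vsup x y : V x -> V y -> V (vsup x y).
  move=> [m [r [u [r0 Au ->]]]] [n [s [v [s0 Av ->]]]].
  pose N := maxn m n; pose C := r + s + 1.
  have C0 : 0 < C by rewrite ltr_wpDl// addr_ge0.
  have scaled t w : 0 <= t -> t <= C -> A N w -> A N.+1 ((t / C) *: w).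
    move=> t0 tC Aw; left; exists w, w, (t / C), 0, 0; rewrite normr0.
    split => //; last by rewrite !scale0r !addr0.
    by rewrite ger0_norm ?divr_ge0 ?(ltW C0)// ler_pdivrMr// mul1r.
  have rC : r <= C by rewrite /C -addrA lerDl addr_ge0.
  have sC : s <= C by rewrite /C addrAC lerDr addr_ge0.
  (* Two levels up: one rescales [u] and [v], the next takes their supremum. *)
  exists N.+2, C, (vsup ((r / C) *: u) ((s / C) *: v)); split; first exact: ltW.
    left; exists ((r / C) *: u), ((s / C) *: v), 0, 0, 1; rewrite normr0 normr1.
    split => //; last by rewrite !scale0r !add0r scale1r.
    - by apply: scaled => //; apply: Ale Au; exact: leq_maxl.
    - by apply: scaled => //; apply: Ale Av; exact: leq_maxr.
  apply: ev_inj => l; rewrite evZ !ev_sup !evZ maxr_pMr ?(ltW C0)//.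
  have Cd t w : C * (t / C * w) = t * w by field; rewrite gt_eqF.
  by rewrite !Cd.
have V0 : V 0 by exists 0%N, 0, 0; rewrite scale0r.
have KV : K `<=` V.
  (* Level [m.+1] contains the part of [K] in the ball of radius [m]; here [m] is the truncated norm
     of [x] plus one. *)
  move=> x Kx; exists (Num.truncn `|x|).+2, 1, x; rewrite scale1r; split => //.
  right; split => //=; have /andP[_ /ltW//] := truncn_itv (normr_ge0 x).
have VN x : V x -> V (- x).
  by move=> Vx; rewrite -[- x]addr0 -scaleN1r; exact: Vlin.
have genV : sublattice_gen K `<=` V.
  apply: smallest_sub KV; split => // x y Vx Vy.
  by rewrite vinfE; apply/VN/Vsup; exact: VN.
have Vspan : V `<=` linear_span W.
  move=> x [n [r [y [r0 Ay ->]]]] S [[S0 Slin] WS].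
  have := Slin (r / c' n) (c' n *: y) 0 _ S0.
  rewrite addr0 scalerA divfK ?gt_eqF//; apply; apply: WS; right; exists n.
  by exists y.
exists W; first exact: (ptcompact_weakly_compact ev_linear ev_le ev_attained ev_compact W1 cW).
by move=> O O0 Oo; have [x [Ox /genV/Vspan Wx]] := dK O O0 Oo; exists x.
Qed.

End LatticeGenerated.

(** * The Hahn-Banach theorem *)

Section HahnBanach.
Variables (R : realType) (V : normedModType R).
Implicit Types (q : V -> R) (x y v : V).

Definition sublinear q := [/\ q 0 <= 0, forall x y, q (x + y) <= q x + q y &
  forall (a : R) x, 0 < a -> q (a *: x) <= a * q x].

Lemma sublinear_ge q x : sublinear q -> - q (- x) <= q x.
Proof.
move=> [q0 qD _]; have := qD x (- x); have := qD 0 0; rewrite addr0 subrr; lra.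
Qed.

(** Lowers [q] along [v]: for sublinear [q], the choices [t = 0] and [t = 1] give
    [tilt q v y <= q y] and [tilt q v (- v) <= - q v]. *)
Definition tilt q v y := inf [set q (y + t *: v) - t * q v | t in [set t | 0 <= t]].

Lemma tilt_has_inf q v y : sublinear q ->
  has_inf [set q (y + t *: v) - t * q v | t in [set t | 0 <= t]].
Proof.
move=> qs; have [q0 qD qZ] := qs; split.
  by exists (q (y + 0 *: v) - 0 * q v), 0 => /=.
exists (- q (- y)) => _ [t /= t0 <-].
(* Homogeneity is assumed as an inequality; the inverse factor yields the reverse one. *)
have tv : t * q v <= q (t *: v).
  move: t0; rewrite le_eqVlt => /predU1P[<-|t0].
    by rewrite mul0r scale0r; have := qD 0 0; rewrite addr0; lra.
  by rewrite -ler_pdivlMl// (le_trans _ (qZ _ _ _)) ?invr_gt0// scalerA mulVf ?gt_eqF// scale1r.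
have := qD (y + t *: v) (- y); rewrite addrAC subrr add0r; lra.
Qed.

Lemma tilt_le q v y t : sublinear q -> 0 <= t ->
  tilt q v y <= q (y + t *: v) - t * q v.
Proof. by move=> qs t0; apply: ge_inf; [have [] := tilt_has_inf v y qs|exists t]. Qed.

Lemma tilt_adherent q v y e : sublinear q -> 0 < e ->
  exists2 t, 0 <= t & q (y + t *: v) - t * q v <= tilt q v y + e.
Proof.
move=> qs e0; have [_ [t /= t0 <-] /ltW te] := inf_adherent e0 (tilt_has_inf v y qs).
by exists t.
Qed.

Lemma tilt_le_id q v y : sublinear q -> tilt q v y <= q y.
Proof. by move=> /(tilt_le v y)/(_ (lexx 0)); rewrite scale0r addr0 mul0r subr0. Qed.

Lemma sublinear_tilt q v : sublinear q -> sublinear (tilt q v).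
Proof.
move=> qs; have [q0 qD qZ] := qs; split.
- exact: le_trans (tilt_le_id v 0 qs) q0.
- move=> x y; apply/ler_addgt0Pr => e e0.
  have e20 : 0 < e / 2 by rewrite divr_gt0.
  have [s s0 hs] := tilt_adherent v x qs e20.
  have [t t0 ht] := tilt_adherent v y qs e20.
  apply: (le_trans (tilt_le v (x + y) qs (addr_ge0 s0 t0))).
  have := qD (x + s *: v) (y + t *: v); rewrite addrACA -scalerDl mulrDl.
  by lra.
- move=> a x a0; rewrite -ler_pdivrMl//; apply/ler_addgt0Pr => e e0.
  have [t t0 ht] := tilt_adherent v x qs e0.
  rewrite ler_pdivrMl// (le_trans (tilt_le v _ qs (mulr_ge0 (ltW a0) t0)))//.
  rewrite -scalerA -scalerDr (le_trans (lerB (qZ _ _ a0) (lexx _)))//.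
  by rewrite -mulrA -mulrBr ler_pM2l.
Qed.

(* A minimal sublinear functional [q] equals its own tilts, and
   [tilt q v y <= q (y + v) - q v] then forces additivity. *)
Lemma hahn_banach q0 : sublinear q0 ->
  exists2 f : V -> R^o, linear f & forall x, f x <= q0 x.
Proof.
move=> q0s; pose T := {q : V -> R | sublinear q /\ forall x, q x <= q0 x}.
pose mk q (h1 : sublinear q) (h2 : forall x, q x <= q0 x) : T :=
  exist (fun q => sublinear q /\ forall x, q x <= q0 x) q (conj h1 h2).
pose Rel (s t : T) := `[< forall x, sval t x <= sval s x >].
(* [Rel] reverses the pointwise order, so a maximal element is a minimal sublinear functional. *)
have [|r s t /asboolP rs /asboolP st|s t /asboolP st /asboolP ts|A Atot|[q [qs qq0]] qmin] :=
  @Zorn T Rel.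
- by move=> t; apply/asboolP.
- by apply/asboolP => x; exact: le_trans (rs x).
- case: s t st ts => s Ps [t Pt] /= st ts; apply/eq_exist/funext => x.
  by apply/le_anti; rewrite ts st.
- have [[a0 Aa0]|A0] := pselect (A !=set0); last first.
    by exists (mk q0 q0s (fun x => lexx _)) => s As; case: A0; exists s.
  pose S x := [set sval a x | a in A].
  have Sinf x : has_inf (S x).
    split; first by exists (sval a0 x), a0.
    exists (- q0 (- x)) => _ [[a [as_ aq0]] /= _ <-].
    by apply: le_trans (sublinear_ge x as_); rewrite lerN2.
  have Sle x a : A a -> inf (S x) <= sval a x.
    by move=> Aa; apply: ge_inf; [case: (Sinf x)|exists a].
  have Sad x e : 0 < e -> exists2 a, A a & sval a x <= inf (S x) + e.
    move=> e0; have [_ [a Aa <-] /ltW ae] := inf_adherent e0 (Sinf x).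
    by exists a.
  have Ss : sublinear (fun x => inf (S x)).
    split.
    - by apply: (le_trans (Sle 0 a0 Aa0)); case: (svalP a0) => -[].
    - move=> x y; apply/ler_addgt0Pr => e e0.
      have e20 : 0 < e / 2 by rewrite divr_gt0.
      have [a Aa ax] := Sad x _ e20; have [b Ab yb] := Sad y _ e20.
      have [_ aD _] := (svalP a).1; have [_ bD _] := (svalP b).1.
      (* Of two members of a chain, the smaller one nearly attains both infima. *)
      have [/asboolP ab|/asboolP ba] := Atot a b Aa Ab.
        by have := Sle (x + y) b Ab; have := bD x y; have := ab x; lra.
      by have := Sle (x + y) a Aa; have := aD x y; have := ba y; lra.
    - move=> c x c0; rewrite -ler_pdivrMl//; apply/ler_addgt0Pr => e e0.
      have [a Aa ax] := Sad x _ e0; rewrite ler_pdivrMl//.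
      have [_ _ aZ] := (svalP a).1.
      by rewrite (le_trans (Sle _ a Aa))// (le_trans (aZ _ _ c0))// ler_pM2l.
  have Sq0 x : inf (S x) <= q0 x.
    by apply: (le_trans (Sle x a0 Aa0)); case: (svalP a0).
  by exists (mk _ Ss Sq0) => s As; apply/asboolP => x; exact: Sle.
have qv v y : q y + q v <= q (y + v).
  have tq x : tilt q v x <= q0 x := le_trans (tilt_le_id v x qs) (qq0 x).
  have /qmin/(congr1 (fun t : T => sval t y))/= <- :
      Rel (mk q qs qq0) (mk _ (sublinear_tilt v qs) tq).
    by apply/asboolP => x; exact: tilt_le_id.
  by have := tilt_le v y qs ler01; rewrite scale1r mul1r lerBrDr.
have [q0_le qD qZ] := qs.
have qDe y v : q (y + v) = q y + q v by apply/le_anti; rewrite qD qv.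
have q00 : q 0 = 0 by have := qDe 0 0; rewrite addr0; lra.
have qN x : q (- x) = - q x by have := qDe x (- x); rewrite subrr q00; lra.
have qZp a x : 0 < a -> q (a *: x) = a * q x.
  move=> a0; apply/le_anti; rewrite qZ//= -lerN2 -mulrN -!qN -scalerN; exact: qZ.
exists q => // a x y; rewrite qDe; congr (_ + _).
have [a0|a0|->] := ltgtP a 0; last by rewrite !scale0r.
  by rewrite -[a]opprK scaleNr qN qZp ?oppr_gt0// scaleNr.
exact: qZp.
Qed.

Lemma linear_bounded_dual (f : V -> R^o) (c : R) :
  linear f -> (forall x, `|f x| <= c * `|x|) ->
  exists phi : dual V, forall x, phi x = f x.
Proof.
move=> fl fc; have flP : f \in functional (R := R) (V := V).
  apply/asboolP; split => //.
  pose F : {linear V -> R^o} := HB.pack f (GRing.isLinear.Build R V R^o *:%R f fl).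
  apply: (linear_bounded_continuous F).1; apply/linear_boundedP.
  exists c; split; first exact: num_real.
  by move=> r cr x; rewrite (le_trans (fc x))// ler_wpM2r// ltW.
by exists (Dual flP).
Qed.

(** Apply [hahn_banach] to the norm tilted along [x]: the bound at [- x] forces [f x] up to the norm
    of [x]. *)
Lemma norming_functional x :
  exists phi : dual V, `|phi| <= 1 /\ phi x = `|x|.
Proof.
have ns : sublinear (fun y => `|y|).
  split; [by rewrite normr0|exact: ler_normD|].
  by move=> a y a0; rewrite normrZ gtr0_norm.
have [f fl fle] := hahn_banach (sublinear_tilt x ns).
have fn y : f y <= `|y| := le_trans (fle y) (tilt_le_id x y ns).
have fN y : f (- y) = - f y.
  have f0 : f 0 = 0 by have := fl 1 0 0; rewrite !scale1r addr0; lra.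
  by have := fl (-1) y 0; rewrite f0 !scaleN1r !addr0.
have fa y : `|f y| <= 1 * `|y|.
  by rewrite mul1r ler_norml fn andbT -[leRHS]opprK lerN2 -fN -(normrN y) fn.
have [phi phif] := linear_bounded_dual fl fa; exists phi; split.
  apply: dual_norm_le => y y1; rewrite phif (le_trans (fa y))// mul1r//.
apply/le_anti; rewrite phif fn/=.
have := le_trans (fle (- x)) (tilt_le x (- x) ns ler01).
by rewrite fN scale1r addNr normr0 mul1r add0r lerN2.
Qed.

End HahnBanach.

(** * Weak*-continuous functions on the dual ball *)

Section SublatticeImage.
Variables (R : numFieldType) (V W : vectorLatticeType R) (f : V -> W).
Hypothesis f_linear : linear f.
Hypothesis f_sup : forall x y, f (vsup x y) = vsup (f x) (f y).

Let f0 : f 0 = 0.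
Proof. by have := f_linear (-1) 0 0; rewrite !scaleN1r !addNr. Qed.

Let f_inf x y : f (vinf x y) = vinf (f x) (f y).
Proof.
have fN z : f (- z) = - f z.
  by have := f_linear (-1) z 0; rewrite !scaleN1r f0 !addr0.
by rewrite !vinfE fN f_sup !fN.
Qed.

Lemma sublattice_gen_image (A : set V) :
  f @` sublattice_gen A = sublattice_gen (f @` A).
Proof.
have [S0 Slin Ssup Sinf] := sublattice_gen_sublattice A.
have [T0 Tlin Tsup Tinf] := sublattice_gen_sublattice (f @` A).
rewrite eqEsubset; split.
  move=> _ [x Ax <-]; suff : sublattice_gen A `<=` f @^-1` sublattice_gen (f @` A) by apply.
  apply: smallest_sub => [|y Ay]; last by apply: sublattice_gen_sub; exists y.
  split => [|a y z|y z|y z] /=.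
  - by rewrite f0.
  - by rewrite f_linear; exact: Tlin.
  - by rewrite f_sup; exact: Tsup.
  - by rewrite f_inf; exact: Tinf.
apply: smallest_sub => [|_ [x Ax <-]]; last by exists x => //; exact: sublattice_gen_sub.
split => [|a _ _ [x Sx <-] [y Sy <-]|_ _ [x Sx <-] [y Sy <-]|_ _ [x Sx <-] [y Sy <-]].
- by exists 0.
- by exists (a *: x + y); [exact: Slin|exact: f_linear].
- by exists (vsup x y); [exact: Ssup|exact: f_sup].
- by exists (vinf x y); [exact: Sinf|exact: f_inf].
Qed.

End SublatticeImage.

Section DualBall.
Variables (R : realType) (E : normedModType R).

Definition dual_ball := {phi : dual E | `|phi| <= 1}.

Implicit Types (l : dual_ball).

(** Evaluations are bounded, so they converge along an ultrafilter, and their limits form a linear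
    functional of norm at most 1. *)
Lemma banach_alaoglu :
  ptcompact (fun (x : E) l => sval l x : R) [set: dual_ball].
Proof.
move=> F FU _.
have /choice[g gP] (x : E) : exists t : R,
    `|t| <= `|x| /\ (fun l => sval l x : R) @ F --> t.
  have [|t tx Ft] := ultra_bounded_cvg (M := `|x|) (fmap_ultra (fun l => sval l x : R) FU).
    apply: (@filterE _ F) => -[phi phi1] /=.
    by rewrite (le_trans (le_dual_norm _ _))// ler_piMl.
  by exists t.
have gl : linear (g : E -> R^o).
  move=> a x y; apply: (cvg_unique (@Rhausdorff R) (gP _).2).
  rewrite (_ : (fun _ => _) = (fun l => a * sval l x + sval l y : R)); last first.
    by apply/funext => l; rewrite linearP.
  by apply: cvgD; [apply: cvgMr; exact: (gP x).2|exact: (gP y).2].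
have [|phi phig] := @linear_bounded_dual _ _ g 1 gl.
  by move=> x; rewrite mul1r; exact: (gP x).1.
have phi1 : `|phi| <= 1.
  by apply: dual_norm_le => x x1; rewrite phig (le_trans (gP x).1).
exists (exist _ phi phi1) => // x; rewrite /= phig; exact: (gP x).2.
Qed.

(** Weak*-continuity on the dual ball, phrased through filters so that [dual_ball] carries no
    topology of its own. *)
Definition wstar_continuous (f : dual E -> R) :=
  forall (F : set_system dual_ball) l, ProperFilter F ->
    (forall x : E, (fun m : dual_ball => sval m x : R) @ F --> (sval l x : R)) ->
    (fun m : dual_ball => f (sval m)) @ F --> f (sval l).

(** [banach_alaoglu] gives a limit of a maximizing sequence along an ultrafilter, and this limit
    attains [s]. *)
Lemma wstar_continuous_attained (f : dual E -> R) (s : R) :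
  wstar_continuous f -> (forall l, `|f (sval l)| <= s) ->
  (forall e, 0 < e -> exists l, s - e < `|f (sval l)|) ->
  exists l, `|f (sval l)| = s.
Proof.
move=> fc fs sf.
have /choice[m hm] n : exists l, s - n.+1%:R^-1 < `|f (sval l)| by apply: sf.
have [U [UU Uoo]] := ultraFilterLemma eventually_filter.
have [//|l _ Ul] := banach_alaoglu (fmap_ultra m UU); first exact: filterT.
exists l; have Uf : (fun n => `|f (sval (m n))|) @ U --> `|f (sval l)|.
  by apply: cvg_norm; exact: (fc _ _ _ Ul).
apply: (cvg_unique (@Rhausdorff R) Uf).
apply: cvg_trans (cvg_app _ Uoo) _; apply/cvgrPdist_lt => d d0.
have /cvgrPdist_lt/(_ d d0)[n0 _ hn0] := @cvg_harmonic R.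
exists n0 => // n /hn0; rewrite /= sub0r normrN gtr0_norm ?invr_gt0//.
rewrite ger0_norm ?subr_ge0// => nd; apply: lt_trans nd.
by have := hm n; rewrite ltrBlDl addrC -ltrBlDl.
Qed.

Lemma wstar_continuous_ext (f g : dual E -> R) :
  (forall phi, f phi = g phi) -> wstar_continuous f -> wstar_continuous g.
Proof. by move=> /funext ->. Qed.

Lemma wstar_continuous_lin a (f g : dual E -> R) :
  wstar_continuous f -> wstar_continuous g ->
  wstar_continuous (fun phi => a * f phi + g phi).
Proof.
by move=> fc gc F l FF Fl; apply: cvgD; [apply: cvgMr; exact: fc|exact: gc].
Qed.

Lemma wstar_continuous_max (f g : dual E -> R) :
  wstar_continuous f -> wstar_continuous g ->
  wstar_continuous (fun phi => Num.max (f phi) (g phi)).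
Proof.
move=> fc gc F l FF Fl; rewrite maxr_absE; under eq_fun do rewrite maxr_absE.
have Ff := fc F l FF Fl; have Fg := gc F l FF Fl.
by apply: cvgMl; apply: cvgD; [exact: cvgD|apply: cvg_norm; exact: cvgB].
Qed.

Lemma wstar_continuous_min (f g : dual E -> R) :
  wstar_continuous f -> wstar_continuous g ->
  wstar_continuous (fun phi => Num.min (f phi) (g phi)).
Proof.
move=> fc gc F l FF Fl; rewrite minr_absE; under eq_fun do rewrite minr_absE.
have Ff := fc F l FF Fl; have Fg := gc F l FF Fl.
by apply: cvgMl; apply: cvgB; [exact: cvgD|apply: cvg_norm; exact: cvgB].
Qed.

Lemma wstar_continuous_lim (f : dual E -> R) :
  (forall e, 0 < e -> exists2 g, wstar_continuous g &
    forall l, `|f (sval l) - g (sval l)| <= e) ->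
  wstar_continuous f.
Proof.
move=> fA F l FF Fl; apply/cvgrPdist_lt => e e0.
have e30 : 0 < e / 3 by rewrite divr_gt0.
have [g gc fg] := fA _ e30.
have /cvgrPdist_lt/(_ _ e30) := gc F l FF Fl.
apply: filterS => m /= gm; have h1 := fg l; have h2 := fg m.
rewrite (_ : f (sval l) - f (sval m) = (f (sval l) - g (sval l)) +
  (g (sval l) - g (sval m)) - (f (sval m) - g (sval m))); last by ring.
rewrite (le_lt_trans (ler_normB _ _))//.
have := ler_normD (f (sval l) - g (sval l)) (g (sval l) - g (sval m)).
by lra.
Qed.

Section Lattice.
Variables (p : \bar R) (p1 : (1 <= p)%E).

Lemma fbl_fin_le (f : fbl_fin E p1) l : `|f (sval l)| <= `|f|.
Proof.
apply: (le_trans (fblFin_eval_le f _)); apply: ler_piMl; last by case: l.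
exact: (normr_ge0 f).
Qed.


Lemma fbl_fin_lin a (f g : fbl_fin E p1) (phi : dual E) :
  (a *: f + g) phi = a * f phi + g phi.
Proof. by []. Qed.

Lemma fbl_finB (f g : fbl_fin E p1) (phi : dual E) :
  (f - g) phi = f phi - g phi.
Proof. by []. Qed.

Lemma fbl_fin_sup (f g : fbl_fin E p1) (phi : dual E) :
  vsup f g phi = Num.max (f phi) (g phi).
Proof. by []. Qed.

Lemma fbl_fin_inf (f g : fbl_fin E p1) (phi : dual E) :
  vinf f g phi = Num.min (f phi) (g phi).
Proof. by []. Qed.

Lemma closed_sublattice_wstar_continuous (A : set (fbl_fin E p1)) :
  (forall f, A f -> wstar_continuous f) ->
  forall f, closure (sublattice_gen A) f -> wstar_continuous f.
Proof.
move=> Ac; have genc : sublattice_gen A `<=` (fun f => wstar_continuous f).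
  apply: smallest_sub Ac; split=> [F l FF Fl|a f g fc gc|f g fc gc|f g fc gc].
  - exact: cvg_cst.
  - exact: (wstar_continuous_ext (fun phi => esym (fbl_fin_lin a f g phi))
      (wstar_continuous_lin (a := a) fc gc)).
  - exact: (wstar_continuous_ext (fun phi => esym (fbl_fin_sup f g phi))
      (wstar_continuous_max fc gc)).
  - exact: (wstar_continuous_ext (fun phi => esym (fbl_fin_inf f g phi))
      (wstar_continuous_min fc gc)).
move=> f /closure_normP fA; apply: wstar_continuous_lim => e /fA[g /genc gc /ltW fg].
by exists g => // l; rewrite -fbl_finB (le_trans (fbl_fin_le _ _)).
Qed.

End Lattice.
End DualBall.

(** * Closed sublattices of FBL^(oo)[E] and the embedding of E *)

Section ClosedSublatticeWCG.
Variables (R : realType) (E : normedModType R) (pinf : (1 <= +oo :> \bar R)%E).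

(** For the exponent [+oo] the norm is a supremum over the dual ball, and weak* compactness makes it
    a maximum; this supplies [ev_attained]. *)
Lemma fbl_norm_attained (f : fbl_fin E pinf) :
  wstar_continuous f -> exists l : dual_ball E, `|f (sval l)| = `|f|.
Proof.
move=> fc; apply: wstar_continuous_attained => //; first exact: fbl_fin_le.
move=> e e0; apply: contrapT => h.
have : `|f| <= `|f| - e.
  rewrite -lee_fin fblFin_normrE; apply: ge_ereal_sup => _ [phi /= phi1 <-].
  rewrite lee_fin leNgt; apply/negP => fphi; apply: h.
  by exists (exist _ phi phi1).
by rewrite lerBrDr gerDl leNgt e0.
Qed.

Lemma closed_sublattice_WCG (A : set (fbl_fin E pinf)) :
  (forall f, A f -> wstar_continuous f) ->
  ptcompact (fun (l : dual_ball E) (f : fbl_fin E pinf) => f (sval l) : R) A ->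
  WCG (closed_sublattice A).
Proof.
move=> Ac cA.
pose X : banachLatticeType R := closed_sublattice A.
pose v (f : X) : fbl_fin E pinf := closed_sublattice_val f.
pose ev (l : dual_ball E) (f : X) : R := v f (sval l).
have Xc (f : X) : wstar_continuous (v f).
  by apply: (closed_sublattice_wstar_continuous Ac); apply/asboolP; exact: (valP f).
have AX f : A f -> f \in closed_sublattice_pred A.
  by move=> Af; apply/asboolP; apply: subset_closure; exact: sublattice_gen_sub.
pose K : set X := [set f | A (v f)].
have KA : v @` K = A.
  rewrite eqEsubset; split=> [_ [f Kf <-]//|f Af].
  by exists (ClosedSublattice (AX f Af)).
apply: (@lattice_WCG R X _ ev _ _ _ _ _ K).
- by move=> l a f g; exact: fbl_fin_lin.
- by move=> l f g; exact: fbl_fin_sup.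
- by move=> l f; exact: fbl_fin_le.
- by move=> f; exact: fbl_norm_attained.
- move=> F FU _; have [//|l _ Fl] := banach_alaoglu FU; first exact: filterT.
  by exists l => // f; exact: (Xc f _ _ _ Fl).
- move=> F FU FK.
  have [//|f Af Ff] := cA _ (fmap_ultra v FU).
  by exists (ClosedSublattice (AX f Af)) => // l; exact: Ff.
(* [v] carries the sublattice generated by [K] onto the one generated by [A], whose closure is the
   whole space by construction. *)
- move=> O [f Of] Oo.
  have /nbhs_normP[e /= e0 eO] : nbhs f O by exact: open_nbhs_nbhs.
  have /asboolP/closure_normP/(_ e e0)[g] := valP f.
  rewrite -[in sublattice_gen _]KA.
  rewrite -(@sublattice_gen_image _ X _ v)//.
  by move=> [h Kh <-] fh; exists h; split => //; exact: eO.
Qed.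

End ClosedSublatticeWCG.

Theorem corollary9p13 (R : realType) (E : completeNormedModType R)
    (p : \bar R) (p1 : (1 <= p)%E) :
  LWCG (FBL E p1) ->
  exists2 X : completeNormedModType R,
    WCG X & exists T : {linear E -> X}, isomorphic_embedding T.
Proof.
move=> [K Kc dK]; pose Y : banachLatticeType R := FBL E p1.
have pinf : (1 <= +oo :> \bar R)%E by exact: leey.
pose v (f : Y) : fbl_fin E p1 := closed_sublattice_val f.
(* The FBL^(p) norm dominates the supremum over the dual ball. *)
have jfin (f : Y) : fblFin_val (v f) \in fbl_finite (E := E) +oo.
  rewrite inE/=; apply: (@le_lt_trans _ _ `|v f|%:E); last exact: ltry.
  apply: ge_ereal_sup => _ [phi /= phi1 <-]; rewrite lee_fin.
  exact: (fbl_fin_le (v f) (exist _ phi phi1)).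
pose j (f : Y) : fbl_fin E pinf := FBLFin pinf (jfin f).
have j_lin : linear j.

  by move=> a f g; apply/val_inj/val_inj/funext => phi; exact: (fbl_fin_lin a (v f) (v g) phi).
have j_sup f g : j (vsup f g) = vsup (j f) (j g) by exact/val_inj.
have jc f : wstar_continuous (j f).
  apply: (@closed_sublattice_wstar_continuous _ _ _ p1 (range (fbl_delta (E := E) p1)) _ (v f)).
    by move=> _ [x _ <-] F l FF; apply.
  by apply/asboolP; exact: (valP f).
have j_le f : `|j f| <= `|f|.
  by have [l <-] := fbl_norm_attained (jc f); exact: (fbl_fin_le (v f) l).
pose A := j @` K.
have Ac f : A f -> wstar_continuous f by move=> [g _ <-].
have eval_dual (phi : dual E) : exists psi : dual Y, forall f, psi f = v f phi.
  apply: (@linear_bounded_dual _ Y (fun f => v f phi) `|phi|).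
    by move=> a f g; exact: fbl_fin_lin.
  by move=> f; exact: fblFin_eval_le.
(* Evaluation at a point of the dual is a bounded functional on [Y], so weak compactness of [K]
   gives pointwise compactness of [A]. *)
have cA : ptcompact (fun (l : dual_ball E) (f : fbl_fin E pinf) => f (sval l) : R) A.
  apply: (ptcompact_image _ ((weakly_compactP K).1 Kc)) => G y FG Gy l.
  have [psi psiE] := eval_dual (sval l).
  rewrite (_ : _ \o j = psi :> (Y -> R)); last by apply/funext => f; rewrite psiE.
  by rewrite (_ : j y (sval l) = psi y); [exact: (Gy psi)|rewrite psiE].
exists (closed_sublattice A); first exact: closed_sublattice_WCG.
have delta_cl x : fbl_delta p1 x \in closed_sublattice_pred (range (fbl_delta (E := E) p1)).
  by apply/asboolP; apply: subset_closure; apply: sublattice_gen_sub; exists x.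
pose dY x : Y := ClosedSublattice (delta_cl x).
have jdY x : j (dY x) = fbl_delta pinf x by exact/val_inj.
(* [K] generates a dense sublattice of [Y], and [j] is a contractive lattice homomorphism, so the
   image of [dY x] is a limit of elements of the sublattice generated by [A]. *)
have Tin x : fbl_delta pinf x \in closed_sublattice_pred A.
  apply/asboolP/closure_normP => e e0.
  have [f [xf Kf]] : ball (dY x) e `&` sublattice_gen K !=set0.
    by apply: dK; [exists (dY x); exact: ballxx|exact: ball_open].
  exists (j f).
    by rewrite -(sublattice_gen_image j_lin j_sup); exists f.
  move: xf; rewrite -ball_normE/= => xf; apply: le_lt_trans xf.
  rewrite -jdY (_ : j (dY x) - j f = j (dY x - f)) ?j_le//; exact/val_inj.
pose T x : closed_sublattice A := ClosedSublattice (Tin x).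
have T_lin : linear T.
  move=> a x y; apply/val_inj/val_inj/val_inj/funext => phi.
  exact: linearP.
pose Tl : {linear E -> closed_sublattice A} := HB.pack T
  (GRing.isLinear.Build R E (closed_sublattice A) *:%R T T_lin).
exists Tl, 1, 1; split=> // x; rewrite !mul1r; apply/andP; split.
  have [phi [phi1 <-]] := norming_functional x.
  rewrite (le_trans (ler_norm _))//.
  exact: (fbl_fin_le (fbl_delta pinf x) (exist _ phi phi1)).
rewrite -lee_fin (_ : `|Tl x| = `|fbl_delta pinf x|)// fblFin_normrE.
exact: fbl_norm_eval.
Qed.
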